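(* In the setting below, the total kinetic energy contained in the four corner regions, $$\sum_{i=1}^4\int_{D_i}\bigl(|u|^2+|v|^2+|w|^2\bigr)\,dx\,dz,$$ does not depend on $t$. Setting: $D=\{(x,z):\ -1<z<0,\ -1<x<z+1\}$; for $\lambda\in(\tfrac12,\tfrac45)$, $a=\sqrt{\lambda/(1-\lambda)}$, $P(\lambda)=\{(x,z):\ a-3+\tfrac1a<z-\tfrac{x}{a}<1-a+\tfrac1a,\ 1-a-\tfrac1a<z+\tfrac{x}{a}<a-1-\tfrac1a\}$, $\chi(x,z,\lambda)$ the indicator of $P(\lambda)$ in $D$; $\tfrac12<\lambda_*<\lambda_{**}<\tfrac45$, $\sigma_0\in C^1[\tfrac12,\tfrac45]$, $\psi(x,z,t)=\int_{\lambda_*}^{\lambda_{**}}\cos(\sqrt\lambda\,t)\sigma_0(\lambda)\chi(x,z,\lambda)\,d\lambda$, $u=-\psi_z$, $v=\int_0^t\psi_z(x,z,s)\,ds$, $w=\psi_x$. For $\mu\in[\lambda_*,\lambda_{**}]$ let $CA(\mu),AB(\mu),BD(\mu),DC(\mu)$ be the sides of $\overline{P(\mu)}$ on the lines $z=1+\frac xa+\frac1a-a$, $z=1-\frac xa-\frac1a-a$, $z=\frac xa+\frac1a+a-3$, $z=-\frac xa-\frac1a+a-1$ ($a=a(\mu)$), $\Sigma_{CA}=\bigcup_{\mu\in[\lambda_*,\lambda_{**}]}CA(\mu)$ and similarly $\Sigma_{AB},\Sigma_{BD},\Sigma_{DC}$; and $D_1,D_2,D_3,D_4$ are the interiors of $\Sigma_{CA}\cap\Sigma_{DC}$,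 $\Sigma_{CA}\cap\Sigma_{AB}$, $\Sigma_{AB}\cap\Sigma_{BD}$, $\Sigma_{BD}\cap\Sigma_{DC}$.
   Context: $(u,v,w)$ is the velocity field of an inertial wave, i.e. a solution of the linearized rotating-fluid system $u_t=v-p_x$, $v_t=-u$, $w_t=-p_z$, $u_x+w_z=0$ in $D$ with $un_1+wn_3=0$ on $\partial D$; for such solutions the total kinetic energy $\int_D(|u|^2+|v|^2+|w|^2)\,dx\,dz$ is conserved. $D_1,\dots,D_4$ are the corner regions of the decomposition of $D$ by $\partial P(\lambda_* )$ and $\partial P(\lambda_{**})$. *)

(* Defs.v *)
From HB Require Import structures.
From mathcomp Require Import all_boot all_order all_algebra.
From mathcomp Require Import all_classical all_reals all_analysis.
Set Implicit Arguments. Unset Strict Implicit. Unset Printing Implicit Defensive.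
Import Order.TTheory GRing.Theory Num.Theory.
Import numFieldNormedType.Exports.
Local Open Scope classical_set_scope.
Local Open Scope ring_scope.

Section InertialWave.
Variable R : realType.

(* points of the plane are pairs (x, z) *)
Definition domD : set (R * R) :=
  [set p | -1 < p.2 < 0 /\ -1 < p.1 < p.2 + 1].

Definition aof (l : R) : R := Num.sqrt (l / (1 - l)).

Definition Pset (l : R) : set (R * R) :=
  let a := aof l in
  [set p | a - 3 + a^-1 < p.2 - p.1 / a < 1 - a + a^-1 /\
           1 - a - a^-1 < p.2 + p.1 / a < a - 1 - a^-1].

Definition chi (p : R * R) (l : R) : R := \1_(domD `&` Pset l) p.

Definition psi (l1 l2 : R) (sigma0 : R -> R) (x z t : R) : R :=
  Rintegral lebesgue_measure `[l1, l2]
    (fun l => cos (Num.sqrt l * t) * sigma0 l * chi (x, z) l).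

Definition psi_x l1 l2 sigma0 (x z t : R) : R :=
  derive1 (fun y => psi l1 l2 sigma0 y z t) x.
Definition psi_z l1 l2 sigma0 (x z t : R) : R :=
  derive1 (fun y => psi l1 l2 sigma0 x y t) z.

Definition oint0 (t : R) (f : R -> R) : R :=
  if 0 <= t then Rintegral lebesgue_measure `[0, t] f
  else - Rintegral lebesgue_measure `[t, 0] f.

Definition uvel l1 l2 sigma0 x z t : R := - psi_z l1 l2 sigma0 x z t.
Definition vvel l1 l2 sigma0 x z t : R :=
  oint0 t (fun s => psi_z l1 l2 sigma0 x z s).
Definition wvel l1 l2 sigma0 x z t : R := psi_x l1 l2 sigma0 x z t.

Definition sideCA (mu : R) : set (R * R) :=
  let a := aof mu in closure (Pset mu) `&`
  [set p | p.2 = 1 + p.1 / a + a^-1 - a].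
Definition sideAB (mu : R) : set (R * R) :=
  let a := aof mu in closure (Pset mu) `&`
  [set p | p.2 = 1 - p.1 / a - a^-1 - a].
Definition sideBD (mu : R) : set (R * R) :=
  let a := aof mu in closure (Pset mu) `&`
  [set p | p.2 = p.1 / a + a^-1 + a - 3].
Definition sideDC (mu : R) : set (R * R) :=
  let a := aof mu in closure (Pset mu) `&`
  [set p | p.2 = - p.1 / a - a^-1 + a - 1].

Definition Sigma (side : R -> set (R * R)) (l1 l2 : R) : set (R * R) :=
  \bigcup_(mu in `[l1, l2]) side mu.

Definition corner1 l1 l2 := interior (Sigma sideCA l1 l2 `&` Sigma sideDC l1 l2).
Definition corner2 l1 l2 := interior (Sigma sideCA l1 l2 `&` Sigma sideAB l1 l2).
Definition corner3 l1 l2 := interior (Sigma sideAB l1 l2 `&` Sigma sideBD l1 l2).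
Definition corner4 l1 l2 := interior (Sigma sideBD l1 l2 `&` Sigma sideDC l1 l2).

Definition energy_density l1 l2 sigma0 (t : R) (p : R * R) : R :=
  uvel l1 l2 sigma0 p.1 p.2 t ^+ 2 + vvel l1 l2 sigma0 p.1 p.2 t ^+ 2
  + wvel l1 l2 sigma0 p.1 p.2 t ^+ 2.

Definition energy_on (A : set (R * R)) l1 l2 sigma0 (t : R) : \bar R :=
  (\int[(@lebesgue_measure R \x @lebesgue_measure R)%E]_(p in A)
     (energy_density l1 l2 sigma0 t p)%:E)%E.

Definition corner_energy l1 l2 sigma0 (t : R) : \bar R :=
  (energy_on (corner1 l1 l2) l1 l2 sigma0 t + energy_on (corner2 l1 l2) l1 l2 sigma0 t
   + energy_on (corner3 l1 l2) l1 l2 sigma0 t + energy_on (corner4 l1 l2) l1 l2 sigma0 t)%E.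

End InertialWave.

(* Main.v *)
(** In the coordinate [a = sqrt (lambda / (1 - lambda))], the characteristics of
    slope [1/a] and [-1/b] carrying the sides of the parallelograms [P] serve as
    coordinates [(a, b)] on each corner region, which becomes the triangle
    [a1 < b < a < a2]. There the indicator of [P] is that of [b < a(lambda) < a],
    so [psi = H_t(lambda_a) - H_t(lambda_b)] with [H_t] a primitive of
    [cos (sqrt lambda t) sigma0], and the velocity is a superposition of two
    oscillations of frequencies [sqrt lambda_a] and [sqrt lambda_b]. Because
    [1 / lambda_a = 1 + 1 / a^2], the squares of each of the two contribute a
    time-independent energy density. The cross term, transported to the
    [(a, b)]-triangle, has the same density at all four corners up to the sign
    [s r] of the product of the [z]-derivatives of [a] and [b]; the four signs
    [-1, 1, -1, 1] cancel. *)
Require Import Defs.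
From HB Require Import structures.
From mathcomp Require Import all_boot all_order all_algebra.
From mathcomp Require Import all_classical all_reals all_analysis.
From mathcomp Require Import measurable_realfun.
From mathcomp Require Import ring lra.
Set Implicit Arguments.
Unset Strict Implicit.
Unset Printing Implicit Defensive.
Import Order.TTheory GRing.Theory Num.Theory.
Import numFieldNormedType.Exports.
Local Open Scope classical_set_scope.
Local Open Scope ring_scope.

(** The range of lambda is exactly [1 < a < 2], and these two bounds drive all the quadratic
    inequalities. The density common to the four corners comes from the gradients of the
    coordinates, [JA * (-1/a, 1)] for [a] and [JB * (1/b, 1)] for [b]: their determinant gives
    [|JA JB| dx dz = ab/(a+b) da db]. The product of the two amplitudes contains precisely
    [JA * JB], so after transport the corner survives only through the sign of that product. The
    obstacle is to justify this change of variables for a signed integrand. It is split into two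
    one-dimensional substitutions for nonnegative functions, joined by Tonelli and applied
    separately to the positive and negative parts. Since energies are extended reals, the
    cancellation also needs every term to be finite. This holds because the corners are bounded and
    the derivatives of the two quadratics at their roots, which are the denominators of [JA] and
    [JB], stay above [a1 - 1 > 0]. *)

(** * The parallelograms as quadratic inequalities in [a] *)

Section Geometry.
Variable R : realType.
Implicit Types (s r a b l x z : R) (p : R * R).

(* With [X = x + 1], the sides CA and BD of [P] lie on [fp (-1) p a = 0] and
   [fp 1 p a = 0], and the sides AB and DC on [gm (-1) p a = 0] and
   [gm 1 p a = 0]. *)
Definition fp s p a : R := a ^+ 2 - (s * p.2 + 2 + s) * a + s * (p.1 + 1).
Definition gm r p b : R := b ^+ 2 - (r * p.2 + 1) * b - r * (p.1 + 1).

Definition is_sign s := s = 1 \/ s = -1.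

Definition lam a : R := a ^+ 2 / (1 + a ^+ 2).

Lemma lam_den_gt0 a : 0 < 1 + a ^+ 2.
Proof. by have := sqr_ge0 a; lra. Qed.

Lemma aof_ge0 l : 0 <= aof l.
Proof. exact: sqrtr_ge0. Qed.

Lemma aof_sqr l : 0 <= l < 1 -> aof l ^+ 2 = l / (1 - l).
Proof.
move=> /andP[l0 l1]; rewrite sqr_sqrtr// divr_ge0//; lra.
Qed.

Lemma lam_aof l : 0 <= l < 1 -> lam (aof l) = l.
Proof.
move=> /[dup] /aof_sqr e /andP[l0 l1]; rewrite /lam e.
field. by apply/andP; split; apply/eqP; lra.
Qed.

Lemma aof_lam a : 0 <= a -> aof (lam a) = a.
Proof.
move=> a0; rewrite /aof /lam.
have := lam_den_gt0 a => d0.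
rewrite (_ : _ / _ = a ^+ 2); first by rewrite sqrtr_sqr ger0_norm.
by field; rewrite addrK oner_neq0 andbT gt_eqF.
Qed.

Lemma lam_lt a b : 0 <= a -> 0 <= b -> (lam a < lam b) = (a < b).
Proof.
move=> a0 b0; rewrite /lam ltr_pdivrMr ?lam_den_gt0// mulrAC.
rewrite ltr_pdivlMr ?lam_den_gt0// -[RHS](ltr_pXn2r (n := 2)) ?nnegrE//.
by apply/idP/idP => ?; lra.
Qed.

Lemma lam_le a b : 0 <= a -> 0 <= b -> (lam a <= lam b) = (a <= b).
Proof. by move=> a0 b0; rewrite !leNgt lam_lt. Qed.

Lemma aof_gt1 l : 2^-1 < l < 1 -> 1 < aof l.
Proof.
move=> /andP[l0 l1]; rewrite -lam_lt ?aof_ge0// lam_aof; last by apply/andP; split; lra.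
by rewrite /lam expr1n ltr_pdivrMr; lra.
Qed.

Lemma aof_lt2 l : 2^-1 < l < 4 / 5 -> aof l < 2.
Proof.
move=> /andP[l0 l1]; rewrite -lam_lt ?aof_ge0// lam_aof; last by apply/andP; split; lra.
by rewrite /lam ltr_pdivlMr; lra.
Qed.

(** Multiplying the inequalities of [Pset] by [a > 0] removes the divisions: they become quadratic
    in [a] while staying affine in [p]. *)
Definition Pa a : set (R * R) :=
  [set p | [/\ fp 1 p a < 0, fp (-1) p a < 0, 0 < gm 1 p a & 0 < gm (-1) p a]].
Definition cPa a : set (R * R) :=
  [set p | [/\ fp 1 p a <= 0, fp (-1) p a <= 0, 0 <= gm 1 p a & 0 <= gm (-1) p a]].

Lemma fp1E p a : a != 0 -> fp 1 p a = a * (a - 3 + a^-1 - (p.2 - p.1 / a)).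
Proof. by move=> a0; rewrite /fp; field. Qed.
Lemma fpN1E p a : a != 0 -> fp (-1) p a = a * ((p.2 - p.1 / a) - (1 - a + a^-1)).
Proof. by move=> a0; rewrite /fp; field. Qed.
Lemma gm1E p a : a != 0 -> gm 1 p a = a * (a - 1 - a^-1 - (p.2 + p.1 / a)).
Proof. by move=> a0; rewrite /gm; field. Qed.
Lemma gmN1E p a : a != 0 -> gm (-1) p a = a * ((p.2 + p.1 / a) - (1 - a - a^-1)).
Proof. by move=> a0; rewrite /gm; field. Qed.

Lemma PsetE l : 0 < aof l -> Pset l = Pa (aof l).
Proof.
move=> a0; have an0 : aof l != 0 by rewrite gt_eqF.
apply/seteqP; split => p; rewrite /Pset /Pa /= fp1E// fpN1E// gm1E// gmN1E//.
  move=> [/andP[? ?] /andP[? ?]]; split; rewrite ?pmulr_rlt0 ?pmulr_rgt0//; lra.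
rewrite !pmulr_rlt0// !pmulr_rgt0// => -[? ? ? ?].
by split; apply/andP; split; lra.
Qed.

Lemma fp_continuous s a : continuous (fun p => fp s p a).
Proof.
move=> p; rewrite /fp.
apply: cvgD; last first.
  by apply: cvgMl_tmp; apply: cvgD; [exact: cvg_fst|exact: cvg_cst].
apply: cvgB; first exact: cvg_cst.
apply: cvgMr_tmp; apply: cvgD; last exact: cvg_cst.
by apply: cvgD; [apply: cvgMl_tmp; exact: cvg_snd|exact: cvg_cst].
Qed.

Lemma gm_continuous s a : continuous (fun p => gm s p a).
Proof.
move=> p; rewrite /gm.
apply: cvgB; last first.
  by apply: cvgMl_tmp; apply: cvgD; [exact: cvg_fst|exact: cvg_cst].
apply: cvgB; first exact: cvg_cst.
apply: cvgMr_tmp; apply: cvgD; last exact: cvg_cst.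
by apply: cvgMl_tmp; exact: cvg_snd.
Qed.

Lemma closed_cPa a : closed (cPa a).
Proof.
have -> : cPa a = (fun p => fp 1 p a) @^-1` [set y | y <= 0] `&`
   (fun p => fp (-1) p a) @^-1` [set y | y <= 0] `&`
   ((fun p => gm 1 p a) @^-1` [set y | 0 <= y] `&`
   (fun p => gm (-1) p a) @^-1` [set y | 0 <= y]).
  by apply/seteqP; split => p /=; [move=> [? ? ? ?]|move=> [[? ?] [? ?]]].
have fc s := closed_comp (fun p _ => @fp_continuous s a p) (@closed_le R 0).
have gc s := closed_comp (fun p _ => @gm_continuous s a p) (@closed_ge R 0).
by apply: closedI; apply: closedI; [exact: fc|exact: fc|exact: gc|exact: gc].
Qed.

(** Serves two purposes: approaching a boundary point from inside a parallelogram, and leaving an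
    interior point in a chosen direction. *)
Lemma cvg_ray p (u v : R) :
  (p.1 + t * u, p.2 + t * v) @[t --> (0 : R)^'+] --> p.
Proof.
have seg (c d : R) : c + t * d @[t --> (0 : R)^'+] --> c.
  suff : c + t * d @[t --> (0 : R)] --> c + 0 * d.
    by rewrite mul0r addr0 => h; apply: cvg_at_right_filter.
  apply: cvgD; first exact: cvg_cst.
  by apply: cvgM; [exact: cvg_id|exact: cvg_cst].
exact: (cvg_pair (seg _ _) (seg _ _)).
Qed.

Lemma closure_Pa a : 1 < a < 2 -> closure (Pa a) = cPa a.
Proof.
move=> /andP[a1 a2]; apply/seteqP; split.
  have /closure_id -> := @closed_cPa a.
  by apply: closureS => q [*]; split; exact: ltW.
move=> p [h1 h2 h3 h4] B.
(* [(a/2 - 1, -1/2)] is the centre of the parallelogram: there both [fp] equal [-a(2 - a)] and both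
   [gm] equal [a(a - 1)]. As [fp] and [gm] are affine in [p], any step towards it makes the four
   inequalities strict. *)
have mid_cvg := @cvg_ray p (a / 2 - 1 - p.1) (- 2^-1 - p.2).
move=> /mid_cvg; rewrite /nbhs /= => HB.
have : \forall t \near 0^'+, Pa a (p.1 + t * (a / 2 - 1 - p.1), p.2 + t * (- 2^-1 - p.2)).
  near=> t.
  have t0 : 0 < t by [].
  have t1 : t < 1 by near: t; exact: nbhs_right_lt.
  have c0 : t * (a * (2 - a)) > 0 by rewrite !mulr_gt0//; lra.
  have c1 : t * (a * (a - 1)) > 0 by rewrite !mulr_gt0//; lra.
  move: h1 h2 h3 h4; rewrite /Pa/= /fp /gm /= => h1 h2 h3 h4.
  split; nra.
move=> HP; have [t [? ?]] := filter_ex (filterI HB HP).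
by exists (p.1 + t * (a / 2 - 1 - p.1), p.2 + t * (- 2^-1 - p.2)).
Unshelve. all: by end_near.
Qed.

End Geometry.

(** * The characteristic coordinates on a corner region *)

Section Region.
Variable R : realType.
Implicit Types (s r a b l x z q c : R) (p : R * R).

(** The larger root of [y^2 - q y + c]. The square root is 0 on negative discriminants, so this is a
    total function of [q] and [c], measurable in the point. *)
Definition big_root q c : R := (q + Num.sqrt (q ^+ 2 - 4 * c)) / 2.

Lemma big_root_unique q c a : a ^+ 2 - q * a + c = 0 -> q < 2 * a -> big_root q c = a.
Proof.
move=> e qa; rewrite /big_root (_ : q ^+ 2 - 4 * c = (2 * a - q) ^+ 2); last first.
  by rewrite (_ : c = q * a - a ^+ 2); [ring|lra].
by rewrite sqrtr_sqr ger0_norm; lra.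
Qed.

(** A negative value at [a] forces two real roots with [a] strictly between them: [q^2 - 4c] exceeds
    [(2a - q)^2]. *)
Lemma big_rootP q c a : a ^+ 2 - q * a + c < 0 ->
  [/\ big_root q c ^+ 2 - q * big_root q c + c = 0, a < big_root q c &
      q < 2 * big_root q c].
Proof.
move=> h; have d0 : 0 < q ^+ 2 - 4 * c by have := sqr_ge0 (2 * a - q); lra.
have := sqr_sqrtr (ltW d0); have := d0; rewrite -sqrtr_gt0.
rewrite /big_root; set S := Num.sqrt _ => S0 S2.
split; [lra| |lra].
by rewrite ltNge; apply/negP => ?; nra.
Qed.

(** The coordinates [a] and [b] of the point. Taking the larger root is right because, in [domD],
    any root above 1 of either quadratic is the larger one. *)
Definition Asol s p := big_root (s * p.2 + 2 + s) (s * (p.1 + 1)).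
Definition Bsol r p := big_root (r * p.2 + 1) (- (r * (p.1 + 1))).

(* The signs [(s, r) = (-1, 1), (-1, -1), (1, -1), (1, 1)] give the corners at
   the vertices C, A, B, D. *)
Definition corner_set s r a1 a2 : set (R * R) :=
  [set p | [/\ domD p, 0 < fp s p a2 & gm r p a1 < 0]].

(** Puts 1 strictly between the two roots of [fp s p]. This replaces monotonicity, since the vertex
    of this parabola may lie to the right of 1. *)
Lemma fp1_lt0 s p : is_sign s -> domD p -> fp s p 1 < 0.
Proof.
by move=> [->|->] [/andP[? ?] /andP[? ?]]; rewrite /fp; lra.
Qed.

Lemma fpB s p a b : fp s p a - fp s p b = (a - b) * (a + b - (s * p.2 + 2 + s)).
Proof. by rewrite /fp; ring. Qed.

Lemma gmB r p a b : gm r p a - gm r p b = (a - b) * (a + b - (r * p.2 + 1)).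
Proof. by rewrite /gm; ring. Qed.

Lemma fpN s p a : fp s p a + fp (- s) p a = 2 * a * (a - 2).
Proof. by rewrite /fp; ring. Qed.

Lemma gmN r p a : gm r p a + gm (- r) p a = 2 * a * (a - 1).
Proof. by rewrite /gm; ring. Qed.

Lemma sign_slope r p : is_sign r -> -1 <= p.2 <= 0 -> r * p.2 + 1 <= 2.
Proof. by move=> [->|->] /andP[? ?]; lra. Qed.

(** The vertex [(r z + 1) / 2] of this parabola is at most 1, hence it increases on [[1, +oo[]. *)
Lemma gm_lt r p a b : is_sign r -> -1 <= p.2 <= 0 -> 1 <= a -> a < b ->
  gm r p a < gm r p b.
Proof.
move=> hr hp a1 ab; have := sign_slope hr hp; have := gmB r p b a.
have : 0 < b - a by lra.
by nra.
Qed.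

Lemma Asol_unique s p a : is_sign s -> domD p -> 1 < a -> fp s p a = 0 -> Asol s p = a.
Proof.
move=> hs hp a1 e; apply: big_root_unique; first exact: e.
have := fp1_lt0 hs hp; have := fpB s p a 1; rewrite e => h1 h2.
by nra.
Qed.

Lemma Bsol_unique r p b : is_sign r -> domD p -> 1 < b -> gm r p b = 0 -> Bsol r p = b.
Proof.
move=> hr hp b1 e; apply: big_root_unique; first exact: e.
have hz : -1 <= p.2 <= 0 by case: hp => /andP[? ?] _; lra.
by have := sign_slope hr hz; lra.
Qed.

(** The two [slope] fields bound from below the derivatives of the quadratics at their roots. They
    make implicit differentiation legitimate and later keep [JA] and [JB] bounded. *)
Record sols s r a1 a2 p : Prop := Sols {
  fpA : fp s p (Asol s p) = 0 ;
  gmBs : gm r p (Bsol r p) = 0 ;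
  lt1B : a1 < Bsol r p ;
  ltBA : Bsol r p < Asol s p ;
  ltA2 : Asol s p < a2 ;
  slopeA : Asol s p - 1 < 2 * Asol s p - (s * p.2 + 2 + s) ;
  slopeB : 2 * Bsol r p - 2 <= 2 * Bsol r p - (r * p.2 + 1) }.

(** The source of [b < a]: where [fp s p] is negative, the parameter lies below its larger root.
    Eliminating [x] through [gm r p b = 0] reduces the claim to the inequalities of [domD]. *)
Lemma fp_at_gm0 s r p b : is_sign s -> is_sign r -> domD p -> 1 < b ->
  gm r p b = 0 -> fp s p b < 0.
Proof.
move=> hs hr [/andP[? ?] /andP[? ?]] b1; rewrite /fp /gm => e.
by case: hs => ->; case: hr e => -> e; nra.
Qed.

Lemma corner_sols s r a1 a2 p : is_sign s -> is_sign r -> 1 < a1 -> 1 < a2 ->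
  corner_set s r a1 a2 p -> sols s r a1 a2 p.
Proof.
move=> hs hr h1 h2 [hp hf hg].
have hz : -1 <= p.2 <= 0 by case: hp => /andP[? ?] _; lra.
have f1 := fp1_lt0 hs hp.
have [eA A1 qA] := big_rootP f1; rewrite -/(Asol s p) in eA A1 qA.
have hg' : a1 ^+ 2 - (r * p.2 + 1) * a1 + - (r * (p.1 + 1)) < 0 by [].
have [eB B1 qB] := big_rootP hg'; rewrite -/(Bsol r p) in eB B1 qB.
have {}eA : fp s p (Asol s p) = 0 by [].
have {}eB : gm r p (Bsol r p) = 0 by [].
have fB : fp s p (Bsol r p) < 0 by apply: fp_at_gm0 hr hp _ eB => //; lra.
(* [s * p.2 + 2 + s - Asol s p] is the other root of [fp s p]; it is below 1 because
   [fp s p 1 < 0]. *)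
have A1q : 0 < Asol s p + 1 - (s * p.2 + 2 + s).
  by have := fpB s p (Asol s p) 1; rewrite eA => ?; nra.
split => //.
- have := fpB s p (Asol s p) (Bsol r p); rewrite eA => e.
  rewrite ltNge; apply/negP => AB; nra.
- have := fpB s p (Asol s p) a2; rewrite eA => e.
  rewrite ltNge; apply/negP => AB; nra.
- lra.
- have := sign_slope hr hz; lra.
Qed.

(** Two of the four inequalities of [Pa] say [b < a'] and [a' < a] for the parameter [a']. The
    opposite two follow. By [fpN], [fp (- s) p] is negative at [Asol]; it is negative at 1 too,
    hence in between by convexity. By [gmN], [gm (- r) p] is positive at [Bsol], hence beyond it. *)
Lemma corner_Pa s r a1 a2 p a : is_sign s -> is_sign r -> 1 < a1 -> a2 < 2 ->
  corner_set s r a1 a2 p -> a1 <= a <= a2 ->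
  Pa a p <-> Bsol r p < a < Asol s p.
Proof.
move=> hs hr h1 h2 hc /andP[ha1 ha2]; have [hp hf hg] := hc.
have h12 : 1 < a2 by lra.
have [eA eB B1 BA A2 sA sB] := corner_sols hs hr h1 h12 hc.
have hz : -1 <= p.2 <= 0 by case: hp => /andP[? ?] _; lra.
have Ns : is_sign (- s) by case: hs => ->; rewrite ?opprK; [right|left].
have Nr : is_sign (- r) by case: hr => ->; rewrite ?opprK; [right|left].
have fs : fp s p a < 0 <-> a < Asol s p.
  have e1 := fpB s p (Asol s p) a.
  rewrite eA in e1; split => h; last by nra.
  by rewrite ltNge; apply/negP => ?; nra.
have gs : 0 < gm r p a <-> Bsol r p < a.
  rewrite -eB; split => h; last by apply: gm_lt => //; lra.
  rewrite ltNge le_eqVlt; apply/negP => /orP[/eqP e|h']; first by move: h; rewrite -e ltxx.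
  by have := gm_lt hr hz _ h'; lra.
have fNs : a < Asol s p -> fp (- s) p a < 0.
  move=> aA; have f1 := fp1_lt0 Ns hp.
  have fA : fp (- s) p (Asol s p) < 0 by have := fpN s p (Asol s p); rewrite eA; nra.
  rewrite ltNge; apply/negP => fa0.
  have q1 : 0 < a + 1 - (- s * p.2 + 2 + - s) by have := fpB (- s) p a 1; nra.
  by have := fpB (- s) p (Asol s p) a; nra.
have gNr : Bsol r p < a -> 0 < gm (- r) p a.
  move=> Ba; apply: lt_trans (gm_lt Nr hz _ Ba); last by lra.
  by have := gmN r p (Bsol r p); rewrite eB add0r => ->; nra.
split.
  move=> [f1 fN1 g1 gN1]; apply/andP; split; [apply/gs|apply/fs].
    by case: hr => ->.
  by case: hs => ->.
move=> /andP[Ba aA]; have := fNs aA; have := gNr Ba.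
move/gs : Ba; move/fs : aA.
by case: hs => ->; case: hr => ->; rewrite ?opprK /Pa.
Qed.

End Region.

(** * Identification of the four corners with [corner_set] *)

Section Corner.
Variable R : realType.
Implicit Types (s r a b l x z c : R) (p : R * R).

(** Equality at an interior point is impossible, since a small step along the gradient [(u, v)]
    strictly increases the function. This turns the weak inequalities satisfied on the closed sides
    into strict ones. *)
Lemma interior_affine_lt (S : set (R * R)) (u v w : R) p : 0 < u ^+ 2 + v ^+ 2 ->
  (forall q : R * R, S q -> u * q.1 + v * q.2 + w <= 0) ->
  S^° p -> u * p.1 + v * p.2 + w < 0.
Proof.
move=> uv Sle Sp.
have HS : \forall t \near (0 : R)^'+, S (p.1 + t * u, p.2 + t * v).
  exact: (@cvg_ray _ p u v).
have Hpos : \forall t \near (0 : R)^'+, 0 < t by exact: nbhs_right_gt.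
have [t [/Sle /= tS t0]] := filter_ex (filterI HS Hpos).
by nra.
Qed.

Definition sideF s a : set (R * R) := [set p | cPa a p /\ fp s p a = 0].
Definition sideG r b : set (R * R) := [set p | cPa b p /\ gm r p b = 0].

Lemma mulf0_iff a y : a != 0 -> a * y = 0 <-> y = 0.
Proof. by move=> a0; split => [/eqP|->]; rewrite ?mulr0// mulf_eq0 (negPf a0) => /eqP. Qed.

Lemma sides_E l : 2^-1 < l < 4 / 5 ->
  [/\ sideCA l = sideF (-1) (aof l), sideAB l = sideG (-1) (aof l),
      sideBD l = sideF 1 (aof l) & sideDC l = sideG 1 (aof l)].
Proof.
move=> hl; have a1 : 1 < aof l by apply: aof_gt1; lra.
have a2 := aof_lt2 hl.
have a0 : 0 < aof l by lra.
have an0 : aof l != 0 by rewrite gt_eqF.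
have cl : closure (Pset l) = cPa (aof l) by rewrite PsetE// closure_Pa// a1 a2.
have fN1 p : fp (-1) p (aof l) = 0 <-> p.2 = 1 + p.1 / aof l + (aof l)^-1 - aof l.
  by rewrite fpN1E//; apply: (iff_trans (mulf0_iff _ an0)); split; lra.
have gN1 p : gm (-1) p (aof l) = 0 <-> p.2 = 1 - p.1 / aof l - (aof l)^-1 - aof l.
  by rewrite gmN1E//; apply: (iff_trans (mulf0_iff _ an0)); split; lra.
have f1 p : fp 1 p (aof l) = 0 <-> p.2 = p.1 / aof l + (aof l)^-1 + aof l - 3.
  by rewrite fp1E//; apply: (iff_trans (mulf0_iff _ an0)); split; lra.
have g1 p : gm 1 p (aof l) = 0 <-> p.2 = - p.1 / aof l - (aof l)^-1 + aof l - 1.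
  by rewrite gm1E//; apply: (iff_trans (mulf0_iff _ an0)); split; lra.
rewrite /sideCA /sideAB /sideBD /sideDC /sideF /sideG cl.
by split; apply/seteqP; split => p /= [? ?]; split => //;
  do ?[exact/fN1|exact/gN1|exact/f1|exact/g1].
Qed.

Lemma aof_itv l1 l2 l : 2^-1 < l1 -> l2 < 4 / 5 -> l1 <= l <= l2 ->
  aof l1 <= aof l <= aof l2.
Proof.
move=> h1 h2 /andP[h3 h4].
have ge0 := aof_ge0.
rewrite -(lam_le (ge0 _ l1) (ge0 _ l)) -(lam_le (ge0 _ l) (ge0 _ l2)).
by rewrite !lam_aof ?h3//; lra.
Qed.

Lemma cPa_closed_domD a p : 1 < a -> a < 2 -> cPa a p ->
  [/\ -1 <= p.2, p.2 <= 0, 0 <= p.1 + 1 & p.1 <= p.2 + 1].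
Proof.
by move=> a1 a2 [h1 h2 h3 h4]; rewrite /fp /gm in h1 h2 h3 h4; split; nra.
Qed.

Lemma open_corner_set s r a1 a2 : open (corner_set s r a1 a2).
Proof.
have -> : corner_set s r a1 a2 =
    (fun p => p.2) @^-1` [set y | y > -1] `&` (fun p => p.2) @^-1` [set y | y < 0] `&`
    ((fun p => p.1) @^-1` [set y | y > -1] `&`
     (fun p => p.2 + 1 - p.1) @^-1` [set y | y > 0]) `&`
    ((fun p => fp s p a2) @^-1` [set y | y > 0] `&`
    (fun p => gm r p a1) @^-1` [set y | y < 0]).
  apply/seteqP; split => p; rewrite /corner_set /domD /=.
    by move=> [[/andP[? ?] /andP[? ?]] ? ?]; do ! split => //; lra.
  by move=> [[[? ?] [? ?]] [? ?]]; split => //; split; apply/andP; split => //; lra.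
apply: openI; [apply: openI; apply: openI|apply: openI].
- by apply: open_comp => [p _|]; [exact: cvg_snd|exact: open_gt].
- by apply: open_comp => [p _|]; [exact: cvg_snd|exact: open_lt].
- by apply: open_comp => [p _|]; [exact: cvg_fst|exact: open_gt].
- apply: open_comp => [p _|]; last exact: open_gt.
  apply: cvgB; last exact: cvg_fst.
  by apply: cvgD; [exact: cvg_snd|exact: cvg_cst].
- by apply: open_comp => [p _|]; [exact: fp_continuous|exact: open_gt].
- by apply: open_comp => [p _|]; [exact: gm_continuous|exact: open_lt].
Qed.

(** From left to right, every defining condition of [corner_set] is affine in [p] and holds weakly
    on the intersection of the two swept families, so it is strict in the interior. Conversely
    [corner_set] is open, and its point [p] lies on the first side of the parallelogram with
    parameter [Asol s p] and on the second side of the one with parameter [Bsol r p]. *)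
Lemma corner_setE s r l1 l2 : is_sign s -> is_sign r ->
  2^-1 < l1 -> l1 < l2 -> l2 < 4 / 5 ->
  (\bigcup_(mu in `[l1, l2]) sideF s (aof mu) `&`
   \bigcup_(mu in `[l1, l2]) sideG r (aof mu))^° =
  corner_set s r (aof l1) (aof l2).
Proof.
move=> hs hr h1 h12 h2.
have a1 : 1 < aof l1 by apply: aof_gt1; lra.
have a2 : aof l2 < 2 by apply: aof_lt2; lra.
have a12 : aof l1 < aof l2 by rewrite -lam_lt ?aof_ge0// !lam_aof; lra.
apply/seteqP; split.
  move=> p; set S := _ `&` _ => Sp.
  have bnd (q : R * R) : S q -> [/\ [/\ -1 <= q.2, q.2 <= 0, 0 <= q.1 + 1 & q.1 <= q.2 + 1],
      0 <= fp s q (aof l2) & gm r q (aof l1) <= 0].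
    move=> [[m /= hm [cq fq]] [n /= hn [cq' gq]]].
    move: hm hn; rewrite !in_itv /= => /(aof_itv h1 h2) /andP[m1 m2].
    move=> /(aof_itv h1 h2) /andP[n1 n2].
    have D : [/\ -1 <= q.2, q.2 <= 0, 0 <= q.1 + 1 & q.1 <= q.2 + 1].
      by apply: cPa_closed_domD cq; lra.
    split => //; case: D => D1 D2 D3 D4.
      have f1 : fp s q 1 <= 0 by case: (hs) => ->; rewrite /fp; lra.
      have q1 : 0 <= aof m + 1 - (s * q.2 + 2 + s).
        by have := fpB s q (aof m) 1; rewrite fq => ?; nra.
      by have := fpB s q (aof l2) (aof m); rewrite fq => ?; nra.
    rewrite -gq; case: (eqVneq (aof l1) (aof n)) => [->//|ne].
    by apply/ltW/gm_lt => //; [apply/andP|lra|rewrite lt_neqAle ne].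
  have str u v w : 0 < u ^+ 2 + v ^+ 2 ->
      (forall q : R * R, S q -> u * q.1 + v * q.2 + w <= 0) -> u * p.1 + v * p.2 + w < 0.
    by move=> uv Sle; exact: interior_affine_lt uv Sle Sp.
  have s2 : s ^+ 2 = 1 by case: hs => ->; ring.
  have r2 : r ^+ 2 = 1 by case: hr => ->; ring.
  split.
  - have e1 : 0 * p.1 + (-1) * p.2 + (-1) < 0.
      by apply: str => [|q /bnd[[? ? ? ?] ? ?]]; lra.
    have e2 : 0 * p.1 + 1 * p.2 + 0 < 0.
      by apply: str => [|q /bnd[[? ? ? ?] ? ?]]; lra.
    have e3 : (-1) * p.1 + 0 * p.2 + (-1) < 0.
      by apply: str => [|q /bnd[[? ? ? ?] ? ?]]; lra.
    have e4 : 1 * p.1 + (-1) * p.2 + (-1) < 0.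
      by apply: str => [|q /bnd[[? ? ? ?] ? ?]]; lra.
    by split; apply/andP; split; lra.
  - rewrite -oppr_lt0 (_ : - _ = (- s) * p.1 + (s * aof l2) * p.2 +
        (- (aof l2 ^+ 2 - (2 + s) * aof l2 + s))); last by rewrite /fp; ring.
    apply: str => [|q /bnd[_ + _]]; last by rewrite /fp; lra.
    by have := sqr_ge0 (s * aof l2); rewrite sqrrN s2; lra.
  - rewrite (_ : gm _ _ _ = (- r) * p.1 + (- (r * aof l1)) * p.2 +
        (aof l1 ^+ 2 - aof l1 - r)); last by rewrite /gm; ring.
    apply: str => [|q /bnd[_ _ +]]; last by rewrite /gm; lra.
    by have := sqr_ge0 (r * aof l1); rewrite !sqrrN r2; lra.
rewrite -open_subsetE; last exact: open_corner_set.
move=> p hp.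
have h1' : 1 < aof l2 by lra.
have [hD _ _] := hp.
have hz : -1 <= p.2 <= 0 by case: hD => /andP[? ?] _; lra.
have [eA eB B1 BA A2 sA sB] := corner_sols hs hr a1 h1' hp.
have Ns : is_sign (- s) by case: hs => ->; rewrite ?opprK; [right|left].
have Nr : is_sign (- r) by case: hr => ->; rewrite ?opprK; [right|left].
have gA : 0 < gm r p (Asol s p) by rewrite -eB; apply: gm_lt => //; lra.
have fB : fp s p (Bsol r p) < 0 by apply: fp_at_gm0 hr hD _ eB => //; lra.
have fNA : fp (- s) p (Asol s p) < 0 by have := fpN s p (Asol s p); rewrite eA; nra.
have gNB : 0 < gm (- r) p (Bsol r p) by have := gmN r p (Bsol r p); rewrite eB; nra.
have gNA : 0 < gm (- r) p (Asol s p) by apply: lt_trans gNB _; apply: gm_lt => //; lra.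
have fNB : fp (- s) p (Bsol r p) < 0.
  have f1 := fp1_lt0 Ns hD.
  rewrite ltNge; apply/negP => fa0.
  have q1 : 0 < Bsol r p + 1 - (- s * p.2 + 2 + - s) by have := fpB (- s) p (Bsol r p) 1; nra.
  by have := fpB (- s) p (Asol s p) (Bsol r p); nra.
have inl a : aof l1 < a -> a < aof l2 -> l1 <= lam a <= l2.
  move=> aa1 aa2.
  rewrite -(@lam_aof _ l1); last lra.
  rewrite -(@lam_aof _ l2); last lra.
  by rewrite !lam_le ?aof_ge0//; lra.
split.
  exists (lam (Asol s p)); first by rewrite /= in_itv /=; apply: inl; lra.
  have A0 : 0 <= Asol s p by lra.
  rewrite (aof_lam A0).
  split; last exact: eA.
  case: hs eA fNA gA gNA => -> eA fNA gA gNA; case: hr gA gNA => -> gA gNA;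
    rewrite ?opprK in eA fNA gA gNA; split; do ?[exact: ltW|by rewrite eA].
exists (lam (Bsol r p)); first by rewrite /= in_itv /=; apply: inl; lra.
have B0 : 0 <= Bsol r p by lra.
rewrite (aof_lam B0).
split; last exact: eB.
case: hr eB gNB fB fNB => -> eB gNB fB fNB; case: hs fB fNB => -> fB fNB;
  rewrite ?opprK in eB gNB fB fNB; split; do ?[exact: ltW|by rewrite eB].
Qed.

Lemma cornersE l1 l2 : 2^-1 < l1 -> l1 < l2 -> l2 < 4 / 5 ->
  [/\ corner1 l1 l2 = corner_set (-1) 1 (aof l1) (aof l2),
      corner2 l1 l2 = corner_set (-1) (-1) (aof l1) (aof l2),
      corner3 l1 l2 = corner_set 1 (-1) (aof l1) (aof l2) &
      corner4 l1 l2 = corner_set 1 1 (aof l1) (aof l2)].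
Proof.
move=> h1 h12 h2.
have sE l : l \in `[l1, l2]%classic -> 2^-1 < l < 4 / 5.
  by rewrite inE /= in_itv /= => /andP[? ?]; lra.
have P1 : is_sign (1 : R) by left.
have N1 : is_sign (-1 : R) by right.
have [SCA SAB SBD SDC] : [/\
   Sigma (@sideCA R) l1 l2 = \bigcup_(mu in `[l1, l2]) sideF (-1) (aof mu),
   Sigma (@sideAB R) l1 l2 = \bigcup_(mu in `[l1, l2]) sideG (-1) (aof mu),
   Sigma (@sideBD R) l1 l2 = \bigcup_(mu in `[l1, l2]) sideF 1 (aof mu) &
   Sigma (@sideDC R) l1 l2 = \bigcup_(mu in `[l1, l2]) sideG 1 (aof mu)].
  by split; apply: eq_bigcupr => l /mem_set /sE /sides_E[].
rewrite /corner1 /corner2 /corner3 /corner4 SCA SAB SBD SDC.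
by split; rewrite -corner_setE// setIC.
Qed.

End Corner.

(** * Differentiation rules in pointwise form *)

Section PointwiseDerivatives.
Variable R : realType.
Implicit Types (f g : R -> R) (x c df dg : R).

Lemma is_derive_constf x c : is_derive x 1 (fun _ : R => c) 0.
Proof. exact: is_derive_cst. Qed.

Lemma is_derive_idf x : is_derive x 1 (fun y : R => y) 1.
Proof. exact: is_derive_id. Qed.

Lemma is_derive_addf f g x df dg : is_derive x 1 f df -> is_derive x 1 g dg ->
  is_derive x 1 (fun y => f y + g y) (df + dg).
Proof. exact: is_deriveD. Qed.

Lemma is_derive_oppf f x df : is_derive x 1 f df -> is_derive x 1 (fun y => - f y) (- df).
Proof. exact: is_deriveN. Qed.

Lemma is_derive_mulf f g x df dg : is_derive x 1 f df -> is_derive x 1 g dg ->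
  is_derive x 1 (fun y => f y * g y) (f x * dg + g x * df).
Proof. exact: is_deriveM. Qed.

Lemma is_derive_invf f x df : f x != 0 -> is_derive x 1 f df ->
  is_derive x 1 (fun y => (f y)^-1) (- (f x) ^- 2 * df).
Proof. exact: is_deriveV. Qed.

Lemma is_derive_sqrf f x df : is_derive x 1 f df ->
  is_derive x 1 (fun y => f y ^+ 2) (2 * f x * df).
Proof.
move=> h; apply: is_derive_eq (is_derive_mulf h h) _.
by rewrite -mulrA mulr2n mulrDl mul1r.
Qed.

Lemma is_derive_sqrtf f x df : 0 < f x -> is_derive x 1 f df ->
  is_derive x 1 (fun y => Num.sqrt (f y)) ((2 * Num.sqrt (f x))^-1 * df).
Proof.
move=> f0 h; have hq := is_derive1_sqrt f0.
by apply: is_derive_eq (is_derive1_comp hq h) _; rewrite mulrC.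
Qed.

End PointwiseDerivatives.

(** * One-dimensional substitution for nonnegative functions *)

Section Substitution.
Variable R : realType.
Notation mu := (@lebesgue_measure R).
Implicit Types (phi dphi : R -> R) (f : R -> \bar R).

Lemma FTC2_closed (phi dphi : R -> R) (c d : R) : c <= d ->
  (forall x, c <= x <= d -> is_derive x 1 phi (dphi x)) ->
  (forall x, c <= x <= d -> {for x, continuous dphi}) ->
  (\int[mu]_(x in `[c, d]) (dphi x)%:E = (phi d - phi c)%:E)%E.
Proof.
rewrite le_eqVlt => /predU1P[<- _ _|cd hd hc].
  by rewrite set_itv1 integral_set1 subrr.
have wc : {within `[c, d], continuous dphi}.
  by apply: continuous_in_subspaceT => x; rewrite inE /= in_itv /=; exact: hc.
have phic x : c <= x <= d -> {for x, continuous phi}.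
  move=> /hd dx; apply/differentiable_continuous/derivable1_diffP.
  by have [] := dx.
rewrite (continuous_FTC2 (F := phi))//.
- split.
  + move=> x; rewrite in_itv /= => /andP[? ?].
    by have [] := hd x _; first lra.
  + by apply: cvg_at_right_filter; apply: phic; lra.
  + by apply: cvg_at_left_filter; apply: phic; lra.
- move=> x; rewrite in_itv /= => /andP[? ?].
  have hx : c <= x <= d by lra.
  by rewrite derive1E; have [_ ->] := hd x hx.
Qed.

Lemma FTC2_open (phi dphi : R -> R) (c d : R) : c <= d ->
  (forall x, c <= x <= d -> is_derive x 1 phi (dphi x)) ->
  (forall x, c <= x <= d -> {for x, continuous dphi}) ->
  (\int[mu]_(x in `]c, d[) (dphi x)%:E = (phi d - phi c)%:E)%E.
Proof.
move=> cd hd hc; rewrite -(FTC2_closed cd hd hc).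
rewrite -(@integral_itv_bndoo _ _ _ _ true false)//.
have wc : {within `[c, d], continuous dphi}.
  by apply: continuous_in_subspaceT => x; rewrite inE /= in_itv /=; exact: hc.
apply/measurable_EFinP; apply: measurable_funS (subspace_continuous_measurable_fun _ wc) => //.
exact: subset_itv_oo_cc.
Qed.

(** Positivity is asked only in the open interval because [dzeta] may vanish at the left endpoint
    [cut]. *)
Lemma increasing_of_derive (phi dphi : R -> R) (c d : R) :
  (forall x, c <= x <= d -> is_derive x 1 phi (dphi x)) ->
  (forall x, c < x < d -> 0 < dphi x) ->
  forall x y, c <= x -> x < y -> y <= d -> phi x < phi y.
Proof.
move=> hd hp x y cx xy yd.
have hd' z : z \in `]x, y[ -> is_derive z 1 phi (dphi z).
  by rewrite in_itv /= => /andP[? ?]; apply: hd; lra.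
have hc : {within `[x, y], continuous phi}.
  apply: derivable_within_continuous => z; rewrite in_itv /= => /andP[? ?].
  by have [] : is_derive z 1 phi (dphi z) by apply: hd; lra.
have [z] := MVT xy hd' hc.
rewrite in_itv /= => /andP[xz zy] e.
have : 0 < dphi z by apply: hp; lra.
by nra.
Qed.

Section increasing.
Variables (phi dphi : R -> R) (c d : R).
Hypotheses (cd : c < d)
  (hd : forall x, c <= x <= d -> is_derive x 1 phi (dphi x))
  (hc : forall x, c <= x <= d -> {for x, continuous dphi})
  (hp : forall x, c < x < d -> 0 < dphi x)
  (mphi : measurable_fun setT phi) (mdphi : measurable_fun setT dphi).

Let D : set (measurableTypeR R) := `]phi c, phi d[.
Let under (p : R * R) : bool := [&& c < p.1, p.1 < d, 0 < p.2 & p.2 < dphi p.1].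
(** The default [phi c] lies outside the open interval [D], so points off the region under the graph
    do not count for subsets of [D]. *)
Let T (p : R * R) : measurableTypeR R := if under p then phi p.1 else phi c.

Let munder : measurable_fun setT under.
Proof.
rewrite /under; apply: measurable_and; first exact: measurable_fun_ltr.
apply: measurable_and; first exact: measurable_fun_ltr.
apply: measurable_and; apply: measurable_fun_ltr => //.
exact: measurableT_comp.
Qed.

Let mT : measurable_fun setT T.
Proof.
apply: measurable_fun_ifT => //.
exact: measurableT_comp.
Qed.

Let incr := increasing_of_derive hd hp.

Let TD p : D (T p) <-> under p.
Proof.
rewrite /D /T /= in_itv /=; case: ifPn => [/and4P[h1 h2 _ _]|_]; last by rewrite ltxx.
split => // _; apply/andP; split; apply: incr => //; lra.
Qed.

(* The measure of the region under the graph of the derivative, transported by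
   the map, is a measure that must agree with Lebesgue measure on the image. *)
Let nu : {measure set (measurableTypeR R) -> \bar R} :=
  measure_function_pushforward__canonical__measure_function_Measure (mu \x mu)%E mT.

Let nuE A : measurable A -> A `<=` D ->
  nu A = (\int[mu]_(x in `]c, d[ `&` phi @^-1` A) (dphi x)%:E)%E.
Proof.
move=> mA AD; rewrite /nu /pushforward /= /product_measure1 /=.
rewrite [RHS]integral_mkcond; apply: eq_integral => x _ /=.
rewrite patchE; case: ifPn => [/set_mem /= [+ hA]|hx].
  rewrite in_itv /= => /andP[cx xd].
  have dx0 : 0 < dphi x by apply: hp; rewrite cx.
  rewrite (_ : xsection _ _ = `]0, dphi x[%classic); last first.
    apply/seteqP; split => y; rewrite /xsection /= inE /= in_itv /= /T /under /=.
      rewrite cx xd /=; case: ifPn => // _ /AD.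
      by rewrite /D /= in_itv /= ltxx.
    by move=> ->; rewrite cx xd.
  by rewrite lebesgue_measure_itv /= lte_fin dx0 oppr0 adde0.
rewrite (_ : xsection _ _ = set0) ?measure0//.
apply/seteqP; split => y //; rewrite /xsection /= inE /= => hA.
have := AD _ hA; move/TD => u; move: hA; rewrite /T u => hA.
case/and4P : u => /= h1 h2 _ _.
by move/negP : hx; apply; apply/mem_set; split => //=; rewrite in_itv /= h1.
Qed.

(** On a ray the claim is the fundamental theorem of calculus: the preimage is []g, d[] with
    [phi g = y'], over which [dphi] integrates to [phi d - y']. *)
Let nu_ray y : nu (`]y, +oo[ `&` D) = mu (`]y, +oo[ `&` D).
Proof.
pose y' := Num.max y (phi c).
have -> : `]y, +oo[%classic `&` D = `]y', phi d[%classic.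
  apply/seteqP; split => z; rewrite /D /y' /= !in_itv /= ?andbT gt_max.
    by move=> [-> /andP[-> ->]].
  by move=> /andP[/andP[-> ->] ->].
have cy' : phi c <= y' by rewrite /y' le_max lexx orbT.
rewrite nuE//; last first.
  by move=> z; rewrite /D /= !in_itv /= => /andP[h ->]; rewrite (le_lt_trans cy').
rewrite lebesgue_measure_itv /= lte_fin; case: ltP => [yd|dy]; last first.
  rewrite (_ : _ `&` _ = set0) ?integral_set0//.
  apply/seteqP; split => z //= []; rewrite !in_itv /= => _ /andP[h1 h2].
  by have := lt_trans h1 h2; rewrite ltNge dy.
have cphi : {within `[c, d], continuous phi}.
  apply: derivable_within_continuous => z; rewrite in_itv /= => /hd h.
  by have [] := h.
have phicd : phi c < phi d by apply: incr.
have [|g] := @IVT _ phi c d y' (ltW cd) cphi.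
  by rewrite min_l ?max_r ?cy' ?ltW.
rewrite in_itv /= => /andP[cg gd] gy.
have gd' : g < d.
  by rewrite lt_neqAle gd andbT; apply/eqP => e; move: yd; rewrite -gy e ltxx.
rewrite (_ : _ `&` _ = `]g, d[%classic); last first.
  apply/seteqP; split => z /=; rewrite !in_itv /= -gy.
    move=> [/andP[cz ->] /andP[h _]]; rewrite andbT ltNge le_eqVlt.
    apply/negP => /orP[/eqP e|zg]; first by move: h; rewrite e ltxx.
    by have := incr (ltW cz) zg gd; rewrite ltNge (ltW h).
  move=> /andP[gz zd]; rewrite zd (le_lt_trans cg gz); split => //.
  by apply/andP; split; apply: incr => //; lra.
have hd' x : g <= x <= d -> is_derive x 1 phi (dphi x).
  by move=> /andP[? ?]; apply: hd; lra.
have hc' x : g <= x <= d -> {for x, continuous dphi}.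
  by move=> /andP[? ?]; apply: hc; lra.
by rewrite (FTC2_open gd hd' hc') gy.
Qed.

(** Open rays to the right form a generating family closed under intersection. Restricting both
    measures to the bounded interval [D] makes them finite on it, so uniqueness of measures
    applies. *)
Let nu_mu A : measurable A -> A `<=` D -> mu A = nu A.
Proof.
move=> mA AD.
have mD : measurable D by exact: measurable_itv.
pose m1 : {measure set (measurableTypeR R) -> \bar R} :=
  measure_function_mrestr__canonical__measure_function_Measure mu mD.
pose m2 : {measure set (measurableTypeR R) -> \bar R} :=
  measure_function_mrestr__canonical__measure_function_Measure nu mD.
suff : m1 A = m2 A by rewrite /m1 /m2 /= /mrestr setIidl.
refine (@measure_unique _ R (measurableTypeR R) (@RGenOInfty.G R)
  (fun k => `](- k%:R), +oo[%classic) _ _ _ _ m1 m2 _ _ A mA).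
- exact: RGenOInfty.measurableE.
- move=> _ _ [x ->] [y ->]; exists (Num.max x y).
  apply/seteqP; split => z /=; rewrite !in_itv /= !andbT gt_max.
    by move=> [-> ->].
  by move=> /andP[].
- by move=> k; exists (- k%:R).
- apply/seteqP; split => // x _.
  exists (Num.trunc `|x|).+1 => //=; rewrite in_itv /= andbT ltrNl.
  apply: le_lt_trans (truncnS_gt _); rewrite -normrN; exact: ler_norm.
- by move=> _ [y ->]; rewrite /m1 /m2 /= /mrestr nu_ray.
- move=> k; apply: (@le_lt_trans _ _ (mu D)).
    by apply: le_measure; rewrite ?inE//; do ?[exact: measurableI|exact: subIsetr].
  by rewrite /D lebesgue_measure_itv /=; case: ifP => // _; rewrite -EFinB ltry.
Qed.

(** Lebesgue measure on [D] is replaced by the transported area under the graph of [dphi]; Tonelli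
    then integrates the constant [f (phi x)] over a vertical segment of length [dphi x]. As [f]
    vanishes off the image, the left side can run over the whole line, like the inner integrals of
    Tonelli. *)
Lemma ge0_substitution_increasing (f : R -> \bar R) :
  measurable_fun setT f -> (forall y, 0 <= f y)%E ->
  (forall y, f y != 0%E -> exists2 x, c < x < d & y = phi x) ->
  (\int[mu]_y f y = \int[mu]_(x in `]c, d[) (f (phi x) * (dphi x)%:E))%E.
Proof.
move=> mf f0 fD.
have mD : measurable D by exact: measurable_itv.
transitivity (\int[mu]_(y in D) f y)%E.
  rewrite [RHS]integral_mkcond; apply: eq_integral => y _.
  rewrite patchE; case: ifPn => // /negP yD; apply/eqP/negP => /negP /fD[x /andP[cx xd] yx].
  by apply: yD; apply/mem_set; rewrite /D /= in_itv /= yx; apply/andP; split;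
    apply: incr => //; exact: ltW.
rewrite (eq_measure_integral nu) //.
rewrite ge0_integral_pushforward//; last exact: measurable_funTS.
transitivity (\int[mu \x mu]_p (if under p then f (phi p.1) else 0))%E.
  rewrite [LHS]integral_mkcond; apply: eq_integral => p _.
  rewrite patchE; case: ifPn => [/set_mem /TD u|/negP h].
    by rewrite u /= /T u.
  by case: ifPn => // u; exfalso; apply: h; apply/mem_set/TD.
rewrite fubini_tonelli1 /=; [|..]; last 2 first.
- apply: measurable_fun_ifT => //.
  by apply: measurableT_comp => //; exact: measurableT_comp.
- by move=> p; case: ifP.
rewrite [RHS]integral_mkcond; apply: eq_integral => x _.
rewrite /fubini_F patchE; case: ifPn => [/set_mem /=|hx].
  rewrite in_itv /= => /andP[cx xd].
  transitivity (\int[mu]_(y in `]0%R, dphi x[) cst (f (phi x)) y)%E.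
    rewrite [RHS]integral_mkcond; apply: eq_integral => y _.
    by rewrite patchE mem_setE in_itv /= /under /= cx xd.
  have dx0 : 0 < dphi x by apply: hp; rewrite cx.
  by rewrite integral_cst//= lebesgue_measure_itv /= lte_fin dx0 oppr0 adde0.
rewrite -[RHS](integral0 mu setT); apply: eq_integral => y _.
case: ifPn => // /and4P[/= h1 h2 _ _]; exfalso; move/negP : hx; apply.
by rewrite mem_setE in_itv /= h1.
Qed.

End increasing.

End Substitution.

(** * Substitution for monotone maps of either direction *)

Section SignedSubstitution.
Variable R : realType.
Notation mu := (@lebesgue_measure R).

Lemma ge0_integral_oppr (f : R -> \bar R) :
  measurable_fun setT f -> (forall y, 0 <= f y)%E ->
  (\int[mu]_y f y = \int[mu]_y f (- y)%R)%E.
Proof.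
move=> mf f0.
rewrite -(@ge0_integral_pushforward _ _ (measurableTypeR R) (measurableTypeR R) R
  (-%R : R -> R) _ mu setT f)//.
by apply: eq_measure_integral => //= A mA _; exact/esym/lebesgue_measureN.
Qed.

(** A decreasing [phi] reduces to the increasing [- phi] by reflecting the integrand. *)
Lemma ge0_substitution (phi dphi : R -> R) (c d : R) (f : R -> \bar R) : c < d ->
  (forall x, c <= x <= d -> is_derive x 1 phi (dphi x)) ->
  (forall x, c <= x <= d -> {for x, continuous dphi}) ->
  (forall x, c < x < d -> 0 < dphi x) \/ (forall x, c < x < d -> dphi x < 0) ->
  measurable_fun setT phi -> measurable_fun setT dphi ->
  measurable_fun setT f -> (forall y, 0 <= f y)%E ->
  (forall y, f y != 0%E -> exists2 x, c < x < d & y = phi x) ->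
  (\int[mu]_y f y = \int[mu]_(x in `]c, d[) (f (phi x) * `|dphi x|%:E))%E.
Proof.
move=> cd hd hc hs mphi mdphi mf f0 fD; case: hs => hp.
  rewrite (ge0_substitution_increasing cd hd hc hp mphi mdphi mf f0 fD).
  apply: eq_integral => x /set_mem /=; rewrite in_itv /= => hx.
  by rewrite gtr0_norm// hp.
rewrite ge0_integral_oppr//.
have hdN (x : R) : c <= x <= d -> is_derive x 1 (fun x : R => - phi x) (- dphi x).
  by move=> hx; apply: is_deriveN; exact: hd.
have hcN x : c <= x <= d -> {for x, continuous (fun x => - dphi x)}.
  by move=> hx; apply: cvgN; exact: hc.
have hpN x : c < x < d -> 0 < - dphi x by move=> hx; rewrite oppr_gt0 hp.
have mphiN : measurable_fun setT (fun x : R => - phi x) by exact: measurableT_comp.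
have mdphiN : measurable_fun setT (fun x : R => - dphi x) by exact: measurableT_comp.
have mfN : measurable_fun setT (fun y : R => f (- y)) by exact: measurableT_comp.
have fDN (y : R) : f (- y) != 0%E -> exists2 x, c < x < d & y = - phi x.
  by move=> /fD[x hx e]; exists x => //; rewrite -e opprK.
have f0N (y : R) : (0 <= f (- y)%R)%E by [].
rewrite (ge0_substitution_increasing cd hdN hcN hpN mphiN mdphiN mfN f0N fDN).
apply: eq_integral => x /set_mem /=; rewrite in_itv /= => hx.
by rewrite opprK ltr0_norm// hp.
Qed.

Lemma measurable_inv : measurable_fun setT (@GRing.inv R).
Proof.
have -> : [set: R] = [set x : R | x != 0] `|` [set 0].
  apply/esym/seteqP; split => // x _ /=.
  by case: (eqVneq x 0) => [->|]; [right|left].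
have op : open [set x : R | x != 0] by exact: open_neq.
apply/measurable_funU => //; first exact: open_measurable.
split; last exact: measurable_fun_set1.
by apply: open_continuous_measurable_fun => // x /set_mem; exact: inv_continuous.
Qed.

Lemma measurable_funV d (T : measurableType d) (f : T -> R) :
  measurable_fun setT f -> measurable_fun setT (fun x => (f x)^-1).
Proof. by move=> mf; apply: measurableT_comp mf; exact: measurable_inv. Qed.

Lemma measurable_sqrt : measurable_fun setT (@Num.sqrt R).
Proof. by apply: continuous_measurable_fun; exact: sqrt_continuous. Qed.

End SignedSubstitution.

Ltac measurability_tac := repeat first
  [ done | exact: measurable_fst | exact: measurable_snd
  | apply: measurable_funD | apply: measurable_funN | apply: measurable_funM
  | apply: measurable_funX | apply: measurable_funV
  | apply: (measurableT_comp (@measurable_sqrt _))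
  | apply: measurable_maxr ].

(** * Derivatives of the coordinates and measurability *)

Section PlaneSubstitution.
Variable R : realType.
Notation mu := (@lebesgue_measure R).

(* The [z]-derivatives of [Asol s] and [Bsol r]; the [x]-derivatives are
   [- JA / Asol] and [JB / Bsol]. *)
Definition JA (s : R) (p : R * R) : R :=
  s * Asol s p / (2 * Asol s p - (s * p.2 + 2 + s)).
Definition JB (r : R) (p : R * R) : R :=
  r * Bsol r p / (2 * Bsol r p - (r * p.2 + 1)).

Lemma measurable_Asol s : measurable_fun setT (@Asol R s).
Proof. rewrite /Asol /big_root; measurability_tac. Qed.

Lemma measurable_Bsol s : measurable_fun setT (@Bsol R s).
Proof. rewrite /Bsol /big_root; measurability_tac. Qed.

Lemma measurable_JA s : measurable_fun setT (JA s).
Proof. rewrite /JA; have mA := @measurable_Asol s; measurability_tac. Qed.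

Lemma measurable_JB s : measurable_fun setT (JB s).
Proof. rewrite /JB; have mA := @measurable_Bsol s; measurability_tac. Qed.

Lemma measurable_corner_set (s r a1 a2 : R) : measurable (corner_set s r a1 a2).
Proof.
pose b (p : R * R) := [&& -1 < p.2, p.2 < 0, -1 < p.1, p.1 < p.2 + 1,
  0 < fp s p a2 & gm r p a1 < 0].
have -> : corner_set s r a1 a2 = b @^-1` [set true].
  apply/seteqP; split => p; rewrite /corner_set /domD /b /=.
    by move=> [[/andP[-> ->] /andP[-> ->]] -> ->].
  by move=> /and5P[-> -> -> -> /andP[-> ->]].
rewrite -[X in measurable X]setTI.
have mb : measurable_fun setT b.
  rewrite /b /fp /gm; do 5! (apply: measurable_and; first by
    apply: measurable_fun_ltr; measurability_tac).
  by apply: measurable_fun_ltr; measurability_tac.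
exact: mb.
Qed.

End PlaneSubstitution.

(** * The inverse map from [(a, b)] to [(x, z)] *)

Section PlaneCoordinates.
Variable R : realType.
Implicit Types (s r x a b : R) (p : R * R).

(** Height at abscissa [x] on the line [fp s _ a = 0]. *)
Definition zeta s x a : R := (x + 1) / a + s * (a - 2) - 1.
Definition dzeta s x a : R := s - (x + 1) / a ^+ 2.
(** Beyond this value [zeta s x] is strictly monotone. For [s = 1] its derivative vanishes at
    [sqrt (x + 1)]; for [s = -1] and [x > -1] the square root takes its default value 0 and the cut
    is 1. *)
Definition cut s x : R := Num.max 1 (Num.sqrt (s * (x + 1))).
Definition xnum s r a b : R := r * (b - 1) - s * (a - 2) + 1.
(** Abscissa of the intersection of the two characteristics: eliminating [z] between [fp s p a = 0]
    and [gm r p b = 0] gives [(x + 1)(a + b) = xnum * a * b]. *)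
Definition xi s r a b : R := xnum s r a b * (a * b / (a + b)) - 1.
Definition dxi s r a b : R :=
  r * (a * b / (a + b)) + xnum s r a b * (a ^+ 2 / (a + b) ^+ 2).

Lemma fp_zeta s x a : is_sign s -> a != 0 -> fp s (x, zeta s x a) a = 0.
Proof. by move=> [->|->] a0; rewrite /fp /zeta /=; field. Qed.

Lemma zetaP s p a : is_sign s -> a != 0 -> fp s p a = 0 -> p.2 = zeta s p.1 a.
Proof.
move=> hs a0 h; apply: (mulfI a0).
have -> : a * zeta s p.1 a = p.1 + 1 + (s * (a - 2) - 1) * a by rewrite /zeta; field.
by move: h; rewrite /fp; case: hs => ->; lra.
Qed.

Lemma cut_lt s x a : 1 < a -> s * (x + 1) < a ^+ 2 -> cut s x < a.
Proof.
move=> a1 h; rewrite /cut gt_max a1 /=.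
have a0 : 0 <= a by lra.
by rewrite -(ger0_norm a0) -sqrtr_sqr ltr_sqrt//; nra.
Qed.

Lemma lt_cut s x a : cut s x < a -> 1 < a /\ s * (x + 1) < a ^+ 2.
Proof.
rewrite /cut gt_max => /andP[a1]; have a0 : 0 <= a by lra.
rewrite -{1}(ger0_norm a0) -sqrtr_sqr ltr_sqrt//; nra.
Qed.

Lemma xnum_pos s r a b : is_sign s -> is_sign r -> 1 < b -> b < a -> a < 2 ->
  0 < xnum s r a b.
Proof. by rewrite /xnum => -[->|->] [->|->]; lra. Qed.

Lemma dxi_sign s r a b : is_sign s -> is_sign r -> 1 < b -> b < a -> a < 2 ->
  0 < r * dxi s r a b.
Proof.
move=> hs hr b1 ba a2; have N0 := xnum_pos hs hr b1 ba a2.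
have ab0 : 0 < a + b by lra.
have -> : r * dxi s r a b =
    (r ^+ 2 * (b * (a + b)) + r * xnum s r a b * a) * (a / (a + b) ^+ 2).
  by rewrite /dxi; field; rewrite gt_eqF.
apply: mulr_gt0; last by apply: divr_gt0; [lra|exact: exprn_gt0].
by case: hs N0 => ->; case: hr => ->; rewrite /xnum => ?; nra.
Qed.

Lemma corner_coord s r a1 a2 p : is_sign s -> is_sign r -> 1 < a1 -> 1 < a2 ->
  corner_set s r a1 a2 p ->
  [/\ p.2 = zeta s p.1 (Asol s p), p.1 = xi s r (Asol s p) (Bsol r p) &
      cut s p.1 < Asol s p].
Proof.
move=> hs hr h1 h2 hp; have [eA eB B1 BA A2 sA sB] := corner_sols hs hr h1 h2 hp.
have A0 : Asol s p != 0 by rewrite gt_eqF//; lra.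
split.
- exact: zetaP.
- have e : p.1 + 1 = xnum s r (Asol s p) (Bsol r p) *
      (Asol s p * Bsol r p / (Asol s p + Bsol r p)).
    have AB0 : Asol s p + Bsol r p != 0 by rewrite gt_eqF//; lra.
    rewrite mulrA; apply: (canRL (mulfK AB0)).
    have eA' : p.2 * Asol s p = p.1 + 1 + (s * (Asol s p - 2) - 1) * Asol s p.
      by case: hs eA => ->; rewrite /fp; lra.
    have eB' : p.2 * Bsol r p = r * (Bsol r p - 1) * Bsol r p - (p.1 + 1).
      by case: hr eB => ->; rewrite /gm; lra.
    have : (p.2 * Asol s p) * Bsol r p = (p.2 * Bsol r p) * Asol s p by ring.
    by rewrite eA' eB' /xnum; lra.
  by rewrite /xi -e addrK.
- apply: cut_lt; first lra.
  by move: eA; rewrite /fp; nra.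
Qed.

(** Surjectivity: each point of the triangle [a1 < b < a < a2] is attained. With [corner_coord] this
    makes the coordinates a bijection from the corner to the triangle. *)
Lemma coord_corner s r a1 a2 a b : is_sign s -> is_sign r -> 1 < a1 -> a2 < 2 ->
  a1 < b -> b < a -> a < a2 ->
  let p := (xi s r a b, zeta s (xi s r a b) a) in
  [/\ corner_set s r a1 a2 p, Asol s p = a, Bsol r p = b & cut s p.1 < a].
Proof.
move=> hs hr h1 h2 a1b ba aa2 p.
have a0 : 0 < a by lra. have b0 : 0 < b by lra.
have an0 : a != 0 by rewrite gt_eqF. have bn0 : b != 0 by rewrite gt_eqF.
have abn0 : a + b != 0 by rewrite gt_eqF//; lra.
have fa : fp s p a = 0 by exact: fp_zeta.
have gb : gm r p b = 0.
  by rewrite /gm /p /zeta /xi /xnum /=; case: hs => ->; case: hr => ->; field; rewrite ?an0 ?abn0 ?bn0.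
have N0 : 0 < xnum s r a b by apply: xnum_pos => //; lra.
have X0 : 0 < p.1 + 1.
  by rewrite /p /= /xi addrNK mulr_gt0// divr_gt0// ?mulr_gt0// addr_gt0.
have eX : (p.1 + 1) * (a + b) = xnum s r a b * (a * b).
  by rewrite /p /xi /=; field.
have ez1 : p.2 * a = p.1 + 1 + (s * (a - 2) - 1) * a.
  by rewrite /p /zeta /=; field.
clearbody p.
have D : domD p.
  rewrite /domD /=.
  have ez : p.2 * (a + b) = (s * (a - 2) - 1) * a + r * (b - 1) * b.
    by move: eX ez1; rewrite /xnum => eX ez1; apply: (mulIf an0); nra.
  move: (p.1) (p.2) X0 eX ez1 ez => x z X0 eX ez1 ez; rewrite /xnum in eX.
  have ab0 : 0 < a + b by lra.
  (* The inequalities of [domD] are checked after multiplication by [a + b], which makes both sides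
     polynomial in [a] and [b]. *)
  have pos y : 0 < y * (a + b) -> 0 < y by rewrite pmulr_lgt0.
  have z1 : 0 < (z + 1) * (a + b).
    by rewrite mulrDl ez; case: hs => ->; case: hr => ->; nra.
  have z0 : 0 < (- z) * (a + b).
    by rewrite mulNr ez; case: hs => ->; case: hr => ->; nra.
  have xz : 0 < (z + 1 - x) * (a + b).
    have -> : (z + 1 - x) * (a + b) = z * (a + b) + 2 * (a + b) - (x + 1) * (a + b) by ring.
    rewrite eX ez; case: hs => ->; case: hr => ->.
    - rewrite [ltRHS](_ : _ = (b + 1) * ((a - b) * (a - 1))); last by ring.
      by rewrite !mulr_gt0//; lra.
    - rewrite [ltRHS](_ : _ = (a - 1) * (a - 3 * b + a * b + b ^+ 2)); last by ring.
      by rewrite mulr_gt0//; [lra|nra].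
    - rewrite [ltRHS](_ : _ = (b + 1) * (a * (2 - a) + (1 - (a - 1) * (b - 1)))); last by ring.
      by rewrite mulr_gt0//; [lra|nra].
    - have h : 0 < (a - b) * (2 - a) by rewrite mulr_gt0//; lra.
      by nra.
  by move: z1 z0 xz => /pos z1 /pos z0 /pos xz; split; apply/andP; split; lra.
have hz : -1 <= p.2 <= 0 by case: D => /andP[? ?] _; lra.
have EA : Asol s p = a by apply: Asol_unique => //; lra.
have EB : Bsol r p = b by apply: Bsol_unique => //; lra.
have f1 := fp1_lt0 hs D.
have a1' : 1 < a by lra.
have q1 : 0 < a + 1 - (s * p.2 + 2 + s).
  have : 0 < (a - 1) * (a + 1 - (s * p.2 + 2 + s)) by rewrite -fpB fa; lra.
  by rewrite pmulr_rgt0//; lra.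
split => //.
  split => //.
    have := fpB s p a2 a; rewrite fa subr0 => ->.
    by rewrite mulr_gt0//; lra.
  by rewrite -gb; apply: gm_lt => //; lra.
apply: cut_lt; first lra.
have : 0 < a * (2 * a - (s * p.2 + 2 + s)) by rewrite mulr_gt0//; lra.
by have := fa; rewrite /fp; lra.
Qed.

(** At fixed [x], [zeta s x] and [Asol s] are inverse functions of one variable, so their
    derivatives are reciprocal. *)
Lemma JA_dzeta s r a1 a2 p : is_sign s -> is_sign r -> 1 < a1 -> 1 < a2 ->
  corner_set s r a1 a2 p -> JA s p * dzeta s p.1 (Asol s p) = 1.
Proof.
move=> hs hr h1 h2 hp; have [eA eB B1 BA A2 sA sB] := corner_sols hs hr h1 h2 hp.
have A0 : Asol s p != 0 by rewrite gt_eqF//; lra.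
rewrite /JA /dzeta.
have d0 : 2 * Asol s p - (s * p.2 + 2 + s) != 0 by rewrite gt_eqF//; lra.
rewrite mulrAC; apply: (canLR (mulfK d0)); rewrite mul1r.
have -> : s * Asol s p * (s - (p.1 + 1) / Asol s p ^+ 2) =
   s ^+ 2 * Asol s p - s * (p.1 + 1) / Asol s p by field.
have -> : s * (p.1 + 1) = ((s * p.2 + 2 + s) - Asol s p) * Asol s p.
  by move: eA; rewrite /fp; lra.
rewrite mulfK//; case: hs => ->; ring.
Qed.

(** Varying [b] at fixed [a] moves the point along a line of slope [1/a], so
    [db = JB (dz + dx/b) = JB (1/a + 1/b) dx]. *)
Lemma JB_dxi s r a1 a2 p : is_sign s -> is_sign r -> 1 < a1 -> 1 < a2 ->
  corner_set s r a1 a2 p -> JB r p * dxi s r (Asol s p) (Bsol r p) =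
  Asol s p * Bsol r p / (Asol s p + Bsol r p).
Proof.
move=> hs hr h1 h2 hp; have [eA eB B1 BA A2 sA sB] := corner_sols hs hr h1 h2 hp.
have [_ ex _] := corner_coord hs hr h1 h2 hp.
have B0 : Bsol r p != 0 by rewrite gt_eqF//; lra.
have AB0 : Asol s p + Bsol r p != 0 by rewrite gt_eqF//; lra.
have d0 : 2 * Bsol r p - (r * p.2 + 1) != 0 by rewrite gt_eqF//; lra.
rewrite /JB mulrAC; apply: (canLR (mulfK d0)).
have -> : dxi s r (Asol s p) (Bsol r p) =
    (r + (p.1 + 1) / Bsol r p ^+ 2) * (Asol s p * Bsol r p / (Asol s p + Bsol r p)).
  by rewrite [in RHS]ex /xi /dxi; field; rewrite AB0.
set w := _ / (Asol s p + _); rewrite mulrA [RHS]mulrC; congr (_ * w).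
have -> : r * Bsol r p * (r + (p.1 + 1) / Bsol r p ^+ 2) =
   r ^+ 2 * Bsol r p + r * (p.1 + 1) / Bsol r p by field.
have -> : r * (p.1 + 1) = (Bsol r p - (r * p.2 + 1)) * Bsol r p.
  by move: eB; rewrite /gm; lra.
rewrite mulfK//; case: hr => ->; ring.
Qed.

End PlaneCoordinates.

(** * The change of variables on a corner region *)

Section PlaneIntegral.
Variable R : realType.
Notation mu := (@lebesgue_measure R).
Implicit Types (s r x a b : R) (p : R * R).

Lemma is_derive_zeta s x a : a != 0 -> is_derive a 1 (zeta s x) (dzeta s x a).
Proof.
move=> a0.
have h := is_derive_addf (is_derive_addf
  (is_derive_mulf (is_derive_constf a (x + 1)) (is_derive_invf a0 (is_derive_idf a)))
  (is_derive_mulf (is_derive_constf a s)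
    (is_derive_addf (is_derive_idf a) (is_derive_constf a (- 2)))))
  (is_derive_constf a (- 1)).
by apply: is_derive_eq h _; rewrite /dzeta; field.
Qed.

Lemma is_derive_xi s r a b : a + b != 0 -> is_derive b 1 (xi s r a) (dxi s r a b).
Proof.
move=> ab0.
have hN := is_derive_addf (is_derive_addf
  (is_derive_mulf (is_derive_constf b r)
    (is_derive_addf (is_derive_idf b) (is_derive_constf b (- 1))))
  (is_derive_constf b (- (s * (a - 2))))) (is_derive_constf b 1).
have hD := is_derive_addf (is_derive_constf b a) (is_derive_idf b).
have hq := is_derive_mulf
  (is_derive_mulf (is_derive_constf b a) (is_derive_idf b)) (is_derive_invf ab0 hD).
have h := is_derive_addf (is_derive_mulf hN hq) (is_derive_constf b (- 1)).
by apply: is_derive_eq h _; rewrite /dxi /xnum; field.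
Qed.

Lemma continuous_dzeta s x a : a != 0 -> {for a, continuous (dzeta s x)}.
Proof.
move=> a0; rewrite /dzeta; apply: cvgB; first exact: cvg_cst.
apply: cvgM; first exact: cvg_cst.
apply: cvgV; first by rewrite expf_neq0.
exact: exprn_continuous.
Qed.

Lemma continuous_dxi s r a b : a + b != 0 -> {for b, continuous (dxi s r a)}.
Proof.
move=> ab0; rewrite /dxi /xnum.
have ci : {for b, continuous (fun y => (a + y)^-1)}.
  by apply: cvgV => //; apply: cvgD; [exact: cvg_cst|exact: cvg_id].
have ci2 : {for b, continuous (fun y => ((a + y) ^+ 2)^-1)}.
  rewrite (_ : (fun y => _) = (fun y => (a + y)^-1 * (a + y)^-1)); last first.
    by apply/funext => y; rewrite expr2 invfM.
  exact: cvgM.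
apply: cvgD.
  apply: cvgM; first exact: cvg_cst.
  by apply: cvgM => //; apply: cvgM; [exact: cvg_cst|exact: cvg_id].
apply: cvgM; last by apply: cvgM; [exact: cvg_cst|exact: ci2].
apply: cvgD; last exact: cvg_cst.
apply: cvgB; last exact: cvg_cst.
apply: cvgM; first exact: cvg_cst.
by apply: cvgB; [exact: cvg_id|exact: cvg_cst].
Qed.

Section substitution.
Variables (s r a1 a2 : R) (k : R -> R -> R).
Hypotheses (hs : is_sign s) (hr : is_sign r) (h1 : 1 < a1) (h12 : a1 < a2) (h2 : a2 < 2).
Hypothesis mk : measurable_fun setT (fun p : R * R => k p.1 p.2).
Hypothesis k0 : forall a b, 0 <= k a b.

Let V := corner_set s r a1 a2.
Let F (p : R * R) : \bar R :=
  ((fun p => (k (Asol s p) (Bsol r p) * `|JA s p * JB r p|)%:E) \_ V) p.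
(** The integrand in the intermediate variables [(x, a)], after [z] has been replaced by
    [zeta s x a] and before [x] is replaced by [xi s r a b]. *)
Let H (q : R * R) : \bar R :=
  if (cut s q.1 < q.2) && (q.2 < 2)
  then (F (q.1, zeta s q.1 q.2) * `|dzeta s q.1 q.2|%:E)%E else 0%E.

Let F0 p : (0 <= F p)%E.
Proof. by rewrite /F patchE; case: ifP => // _; rewrite lee_fin mulr_ge0. Qed.

Let mF : measurable_fun setT F.
Proof.
apply/(measurable_restrictT _ (measurable_corner_set _ _ _ _)).
apply: measurable_funTS; apply/measurable_EFinP.
have mAB : measurable_fun setT (fun p : R * R => (Asol s p, Bsol r p)).
  by apply: measurable_fun_pair; [exact: measurable_Asol|exact: measurable_Bsol].
apply: measurable_funM; first exact: (measurableT_comp mk mAB).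
apply: measurableT_comp => //; apply: measurable_funM.
  exact: measurable_JA.
exact: measurable_JB.
Qed.

Let mzeta : measurable_fun setT (fun q : R * R => zeta s q.1 q.2).
Proof. rewrite /zeta; measurability_tac. Qed.

Let mH : measurable_fun setT H.
Proof.
apply: measurable_fun_ifT => //.
  apply: measurable_and; apply: measurable_fun_ltr; rewrite /cut; measurability_tac.
apply: emeasurable_funM.
  apply: (measurableT_comp mF); apply: measurable_fun_pair; first exact: measurable_fst.
  exact: mzeta.
apply/measurable_EFinP; apply: measurableT_comp => //.
by rewrite /dzeta; measurability_tac.
Qed.

Let H0 q : (0 <= H q)%E.
Proof. by rewrite /H; case: ifP => // _; rewrite mule_ge0. Qed.

Let FV p : F p != 0%E -> V p.
Proof. by rewrite /F patchE; case: ifPn => [/set_mem|]; rewrite ?eqxx. Qed.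

Let h2' : 1 < a2. Proof. exact: lt_trans h12. Qed.

Let intF x : (\int[mu]_z F (x, z) = \int[mu]_a H (x, a))%E.
Proof.
have [/andP[x0 x2]|xN] := boolP ((-1 < x) && (x < 1)); last first.
  have FN z : F (x, z) = 0%E.
    apply/eqP/negP => /negP /FV[[/andP[/= ? ?] /andP[/= ? ?]] _ _].
    by move: xN; rewrite negb_and -!leNgt => /orP[]; lra.
  under eq_integral do rewrite FN.
  under [RHS]eq_integral do rewrite /H FN mul0e if_same.
  by [].
(* The interval of substitution ends at 2 and not at [a2]: since [x + 1 < 2], the cut is always
   below 2, whereas it can exceed [a2]. Nothing is added, as [Asol < a2] wherever [F] is nonzero. *)
have c2 : cut s x < 2 by apply: cut_lt; [lra|case: hs => ->; nra].
have c1 : 1 <= cut s x by rewrite /cut le_max lexx.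
have n0 a : cut s x <= a <= 2 -> a != 0 by move=> /andP[? _]; rewrite gt_eqF//; lra.
have dsgn : (forall a, cut s x < a < 2 -> 0 < dzeta s x a) \/
            (forall a, cut s x < a < 2 -> dzeta s x a < 0).
  case: (hs) => es; [left|right] => a /andP[/lt_cut[a_1 ca] _].
    rewrite /dzeta es subr_gt0 ltr_pdivrMr ?exprn_gt0//; last lra.
    by move: ca; rewrite es; lra.
  rewrite /dzeta es subr_lt0; apply: (@lt_le_trans _ _ 0); first lra.
  by rewrite divr_ge0 ?sqr_ge0//; lra.
have hd a : cut s x <= a <= 2 -> is_derive a 1 (zeta s x) (dzeta s x a).
  by move=> /n0; exact: is_derive_zeta.
rewrite (ge0_substitution c2 hd).
- rewrite [LHS]integral_mkcond; apply: eq_integral => a _.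
  by rewrite patchE mem_setE in_itv /= /H /=; case: ifP.
- by move=> a /n0; exact: continuous_dzeta.
- exact: dsgn.
- exact: (measurable_fun_pair2 x mzeta).
- by rewrite /dzeta; measurability_tac.
- exact: (measurable_fun_pair2 x mF).
- by [].
- move=> z /FV Vp; have [e _ c] := corner_coord hs hr h1 h2' Vp.
  have [_ _ _ _ A2 _ _] := corner_sols hs hr h1 h2' Vp.
  exists (Asol s (x, z)); first by apply/andP; split; [exact: c|exact: lt_trans A2 h2].
  exact: e.
Qed.

(** For [a] in []a1, a2[], the slice is parametrised by [b] in []a1, a[]; the weight [|JA JB|] and
    the two substitution derivatives multiply to [ab/(a+b)] by [JA_dzeta] and [JB_dxi]. *)
Let intH a : (\int[mu]_x H (x, a) =
  if (a1 < a < a2)%R then \int[mu]_(b in `]a1, a[) (k a b * (a * b / (a + b)))%:E else 0)%E.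
Proof.
have [h1' h2''] := (h1, h2).
have HE x : H (x, a) != 0%E -> [/\ cut s x < a, a < 2 & V (x, zeta s x a)].
  rewrite /H /=; case: ifPn => [/andP[? ?]|]; last by rewrite eqxx.
  move=> h; split => //; apply: FV; apply: contra h => /eqP ->.
  by rewrite mul0e.
have VA x : cut s x < a -> V (x, zeta s x a) -> Asol s (x, zeta s x a) = a.
  move=> /lt_cut[a_1 _] [D _ _]; apply: Asol_unique => //.
  by apply: fp_zeta => //; rewrite gt_eqF//; lra.
case: ifPn => [/andP[aa1 aa2]|aN]; last first.
  rewrite -[RHS](integral0 mu setT); apply: eq_integral => x _.
  apply/eqP/negP => /negP /HE[c _ Vp].
  have [_ _ B1 BA A2 _ _] := corner_sols hs hr h1 h2' Vp.
  rewrite (VA _ c Vp) in BA A2.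
  by move/negP : aN; apply; rewrite (lt_trans B1 BA) A2.
have a1_0 : 0 < a1 by exact: lt_trans ltr01 h1.
have n0 b : a1 <= b <= a -> a + b != 0.
  move=> /andP[a1b _]; rewrite gt_eqF// addr_gt0//; first exact: lt_trans aa1.
  exact: lt_le_trans a1b.
have dsgn : (forall b, a1 < b < a -> 0 < dxi s r a b) \/
            (forall b, a1 < b < a -> dxi s r a b < 0).
  case: (hr) => er; [left|right] => b /andP[b1 ba];
    have : 0 < r * dxi s r a b by apply: dxi_sign => //; lra.
    by rewrite er mul1r.
  by rewrite er mulN1r oppr_gt0.
have hd b : a1 <= b <= a -> is_derive b 1 (xi s r a) (dxi s r a b).
  by move=> /n0; exact: is_derive_xi.
rewrite (ge0_substitution aa1 hd).
- apply: eq_integral => b /set_mem /=; rewrite in_itv /= => /andP[b1 ba].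
  have [Vp eA eB c] := coord_corner hs hr h1 h2 b1 ba aa2.
  have a_2 : a < 2 by lra.
  rewrite /H c a_2 /= /F patchE (mem_set Vp) -!EFinM.
  set p := (_, _) in Vp eA eB c *.
  have := JA_dzeta hs hr h1 h2' Vp; have := JB_dxi hs hr h1 h2' Vp.
  rewrite eA eB /= => eJB eJA; congr EFin.
  have e : `|JA s p * JB r p| * `|dzeta s (xi s r a b) a| * `|dxi s r a b| =
      a * b / (a + b).
    transitivity `|JA s p * dzeta s (xi s r a b) a * (JB r p * dxi s r a b)|.
      by rewrite -!normrM; congr Num.norm; ring.
    by rewrite eJA eJB mul1r ger0_norm// divr_ge0 ?mulr_ge0//; lra.
  by rewrite -e; ring.
- by move=> b /n0; exact: continuous_dxi.
- exact: dsgn.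
- by rewrite /xi /xnum; measurability_tac.
- by rewrite /dxi /xnum; measurability_tac.
- exact: (measurable_fun_pair1 a mH).
- by [].
- move=> x /HE[c _ Vp].
  have [_ e _] := corner_coord hs hr h1 h2' Vp.
  have [_ _ B1 BA A2 _ _] := corner_sols hs hr h1 h2' Vp.
  rewrite (VA _ c Vp) in BA A2 e.
  exists (Bsol r (x, zeta s x a)); first by apply/andP.
  exact: e.
Qed.

(* The Jacobian of [(a, b) -> (x, z)] is that of the shear [z = zeta s x a] at
   fixed [x] followed by [x = xi s r a b] at fixed [a]; the result does not
   involve [s] and [r]. *)
Lemma plane_substitution :
  (\int[mu \x mu]_(p in corner_set s r a1 a2)
     (k (Asol s p) (Bsol r p) * `|JA s p * JB r p|)%:E =
   \int[mu]_(a in `]a1, a2[) \int[mu]_(b in `]a1, a[) (k a b * (a * b / (a + b)))%:E)%E.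
Proof.
rewrite integral_mkcond -/F fubini_tonelli1//.
under eq_integral do rewrite /fubini_F intF.
transitivity (\int[mu]_a \int[mu]_x H (x, a))%E; first exact: (@fubini_tonelli _ _ _ _ _ mu mu H mH H0).
under eq_integral do rewrite intH.
rewrite [RHS]integral_mkcond; apply: eq_integral => a _.
by rewrite patchE mem_setE in_itv.
Qed.

End substitution.
End PlaneIntegral.

(** * The velocity field and energy density on a corner *)

Section StreamFunction.
Variable R : realType.
Notation mu := (@lebesgue_measure R).
Implicit Types (s r x z t a b l w : R) (p : R * R).

(** The value is the one from implicit differentiation of [Y^2 - q Y + c = 0]; the hypothesis says
    that the discriminant is positive, so that the square root is differentiable. *)
Lemma is_derive_big_root (q c : R -> R) (y dq dc : R) :
  0 < 2 * big_root (q y) (c y) - q y ->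
  is_derive y 1 q dq -> is_derive y 1 c dc ->
  is_derive y 1 (fun y => big_root (q y) (c y))
    ((dq * big_root (q y) (c y) - dc) / (2 * big_root (q y) (c y) - q y)).
Proof.
rewrite /big_root; set S := Num.sqrt _ => S0 hq hc.
have {}S0 : 0 < S by move: S0; lra.
have d0 : 0 < q y ^+ 2 + - (4 * c y) by rewrite -sqrtr_gt0.
have h4 := is_derive_oppf (is_derive_mulf (is_derive_constf y 4) hc).
have hS := @is_derive_sqrtf _ (fun y => q y ^+ 2 + - (4 * c y)) _ _ d0
  (is_derive_addf (is_derive_sqrf hq) h4).
have h := is_derive_mulf (is_derive_addf hq hS) (is_derive_constf y 2^-1).
apply: is_derive_eq h _; rewrite -/S.
have Sn0 : S != 0 by rewrite gt_eqF.
have -> : 2 * ((q y + S) / 2) - q y = S by field.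
by field.
Qed.

Definition dlam a : R := 2 * a / (1 + a ^+ 2) ^+ 2.

Lemma is_derive_lam a : is_derive a 1 (@lam R) (dlam a).
Proof.
have d0 : 1 + a ^+ 2 != 0 by rewrite gt_eqF// lam_den_gt0.
have h2 := is_derive_sqrf (is_derive_idf a).
have hD := is_derive_addf (is_derive_constf a 1) h2.
have h := is_derive_mulf h2 (@is_derive_invf _ (fun y => 1 + y ^+ 2) a _ d0 hD).
by apply: is_derive_eq h _; rewrite /dlam; field.
Qed.

Lemma is_derive_compf (f g : R -> R) (y df dg : R) :
  is_derive (g y) 1 f df -> is_derive y 1 g dg ->
  is_derive y 1 (fun y => f (g y)) (df * dg).
Proof. exact: is_derive1_comp. Qed.

Lemma oint0_FTC (F f : R -> R) t :
  (forall x, is_derive x 1 F (f x)) -> continuous f -> oint0 t f = F t - F 0.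
Proof.
move=> hF cf; rewrite /oint0 /Rintegral; case: ifPn => [t0|].
  by rewrite (FTC2_closed t0 (fun x _ => hF x) (fun x _ => cf x)).
rewrite -ltNge => /ltW t0.
by rewrite (FTC2_closed t0 (fun x _ => hF x) (fun x _ => cf x)) /= opprB.
Qed.

Lemma is_derive_sinM w t : is_derive t 1 (fun s => sin (w * s)) (w * cos (w * t)).
Proof.
have h := @is_derive_compf sin (fun s => w * s) t _ _ (is_derive_sin (w * t))
  (is_derive_mulf (is_derive_constf t w) (is_derive_idf t)).
by apply: is_derive_eq h _; ring.
Qed.

Lemma continuous_cosM w : continuous (fun t : R => cos (w * t)).
Proof.
move=> t; apply: (@continuous_comp _ _ _ (fun t => w * t) cos).
  by apply: cvgM; [exact: cvg_cst|exact: cvg_id].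
exact: continuous_cos.
Qed.

Lemma oint0_cosB w w' g g' t : w != 0 -> w' != 0 ->
  oint0 t (fun s => cos (w * s) * g - cos (w' * s) * g') =
  sin (w * t) / w * g - sin (w' * t) / w' * g'.
Proof.
move=> w0 w'0.
have hF x : is_derive x 1 (fun s => sin (w * s) / w * g - sin (w' * s) / w' * g')
    (cos (w * x) * g - cos (w' * x) * g').
  have part v c : v != 0 ->
      is_derive x 1 (fun s => sin (v * s) / v * c) (cos (v * x) * c).
    move=> v0.
    have h := is_derive_mulf (is_derive_mulf (is_derive_sinM v x)
      (is_derive_constf x v^-1)) (is_derive_constf x c).
    by apply: is_derive_eq h _; field.
  exact: (is_derive_addf (part _ g w0) (is_derive_oppf (part _ g' w'0))).
rewrite (oint0_FTC t hF); first by rewrite !mulr0 sin0 !mul0r !subr0.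
by move=> x; apply: cvgB; (apply: cvgM; last exact: cvg_cst); exact: continuous_cosM.
Qed.

Section corner.
Variables (s r l1 l2 : R) (sigma : R -> R).
Hypotheses (hs : is_sign s) (hr : is_sign r) (h1 : 2^-1 < l1) (h12 : l1 < l2)
  (h2 : l2 < 4 / 5) (csigma : continuous sigma).

Let a1 := aof l1.
Let a2 := aof l2.
Let V := corner_set s r a1 a2.
Let h t l := cos (Num.sqrt l * t) * sigma l.
Let H t y := \int[mu]_(l in `[l1, y]) h t l.

Let a1_gt1 : 1 < a1. Proof. by move: h1 h12 h2 => *; apply: aof_gt1; lra. Qed.
Let a2_lt2 : a2 < 2. Proof. by move: h1 h12 h2 => *; apply: aof_lt2; lra. Qed.
Let lam_a1 : lam a1 = l1. Proof. by move: h1 h12 h2 => *; apply: lam_aof; lra. Qed.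
Let lam_a2 : lam a2 = l2. Proof. by move: h1 h12 h2 => *; apply: lam_aof; lra. Qed.
Let a12 : a1 < a2. Proof. by rewrite -lam_lt ?aof_ge0// lam_a1 lam_a2. Qed.
Let a2_gt1 : 1 < a2. Proof. exact: lt_trans a12. Qed.

Let ch t : continuous (h t).
Proof.
move=> l; apply: cvgM; last exact: csigma.
apply: (@continuous_comp _ _ _ (fun l => Num.sqrt l * t) cos).
  by apply: cvgM; [exact: sqrt_continuous|exact: cvg_cst].
exact: continuous_cos.
Qed.

Let ih t c d : mu.-integrable `[c, d] (EFin \o h t).
Proof.
apply: continuous_compact_integrable; first exact: segment_compact.
exact/continuous_subspaceT/ch.
Qed.

Let dH t y : l1 < y -> is_derive y 1 (H t) (h t y).
Proof.
move=> ly; have yy : y < y + 1 by rewrite ltrDl.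
have [d e] := continuous_FTC1_closed yy (@ih t l1 (y + 1)) ly (@ch t y).
by apply: (DeriveDef d); rewrite -derive1E; exact: e.
Qed.

Let psiE t p : V p ->
  psi l1 l2 sigma p.1 p.2 t = H t (lam (Asol s p)) - H t (lam (Bsol r p)).
Proof.
move=> Vp; have [eA eB B1 BA A2 sA sB] := corner_sols hs hr a1_gt1 a2_gt1 Vp.
have a0 := lt_trans ltr01 a1_gt1.
have B0 := lt_trans a0 B1; have A0 := lt_trans B0 BA.
have lB : l1 < lam (Bsol r p) by rewrite -lam_a1 lam_lt ?ltW.
have lBA : lam (Bsol r p) < lam (Asol s p) by rewrite lam_lt ?ltW.
have lA : lam (Asol s p) < l2 by rewrite -lam_a2 lam_lt ?ltW// (lt_trans A0).
rewrite /H Rintegral_itvB ?bnd_simp ?ltW//.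
rewrite -Rintegral_itv_bndo_bndc; last first.
  apply: (integrableS _ _ _ (@ih t l1 l2)) => //.
  by move=> l /=; rewrite !in_itv /= => /andP[? ?]; apply/andP; split; lra.
rewrite [RHS](_ : _ =
    \int[mu]_(l in `[l1, l2] `&` `]lam (Bsol r p), lam (Asol s p)[) h t l); last first.
  congr (Rintegral _ _ _); apply/esym/setIidr => l /=.
  by rewrite !in_itv /= => /andP[? ?]; apply/andP; split; lra.
rewrite Rintegral_mkcondr /psi; apply: eq_Rintegral => l /set_mem /= hl.
have hl' : l1 <= l <= l2 by move: hl; rewrite in_itv.
have [hl1 hl2] := andP hl'.
have l01 : 0 <= l < 1 by move: h1 h2 => *; lra.
have al0 : 0 < aof l by have /andP[+ _] := aof_itv h1 h2 hl'; exact: lt_le_trans.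
have [D _ _] := Vp.
have key : (@domD R `&` Pset l) p <-> lam (Bsol r p) < l < lam (Asol s p).
  rewrite (PsetE al0); split.
    move=> [_ /(corner_Pa hs hr a1_gt1 a2_lt2 Vp (aof_itv h1 h2 hl')) /andP[h3 h4]].
    by rewrite -(lam_aof l01) !lam_lt ?ltW// h3.
  rewrite -{1 2}(lam_aof l01) !lam_lt ?ltW// => h3; split => //.
  exact/(corner_Pa hs hr a1_gt1 a2_lt2 Vp (aof_itv h1 h2 hl')).
rewrite /chi -surjective_pairing indicE patchE [in RHS]mem_setE in_itv /=.
case: (boolP (_ < l < _)) => [/key k|/negP nk].
  by rewrite mem_set// mulr1.
by rewrite memNset ?mulr0//; apply: contra_not nk => /key.
Qed.

(** The chain-rule factor of the [z]-derivative of [H t (lam (Asol s p))], stripped of its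
    cosine. *)
Definition amp_A p : R := sigma (lam (Asol s p)) * dlam (Asol s p) * JA s p.
Definition amp_B p : R := sigma (lam (Bsol r p)) * dlam (Bsol r p) * JB r p.
Definition freq_A p : R := Num.sqrt (lam (Asol s p)).
Definition freq_B p : R := Num.sqrt (lam (Bsol r p)).

(** The formula [psiE] holds only on [V], but [V] is open, so it persists along the curve [c] near
    [y] and can be differentiated there. The curve is then taken vertical and horizontal. *)
Let dpsi t p (c : R -> R * R) (y dA dB : R) : c y = p -> V p -> continuous c ->
  is_derive y 1 (fun y => Asol s (c y)) dA -> is_derive y 1 (fun y => Bsol r (c y)) dB ->
  derive1 (fun y => psi l1 l2 sigma (c y).1 (c y).2 t) y =
  h t (lam (Asol s p)) * (dlam (Asol s p) * dA) -
  h t (lam (Bsol r p)) * (dlam (Bsol r p) * dB).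
Proof.
move=> cy Vp cc hA hB; have [eA eB B1 BA A2 sA sB] := corner_sols hs hr a1_gt1 a2_gt1 Vp.
have a0 := lt_trans ltr01 a1_gt1.
have B0 := lt_trans a0 B1; have A0 := lt_trans B0 BA.
have lB : l1 < lam (Bsol r (c y)) by rewrite cy -lam_a1 lam_lt ?ltW.
have lA : l1 < lam (Asol s (c y)) by apply: (lt_trans lB); rewrite cy lam_lt ?ltW.
have dlA := @is_derive_compf _ (fun y => Asol s (c y)) y _ _ (is_derive_lam _) hA.
have dlB := @is_derive_compf _ (fun y => Bsol r (c y)) y _ _ (is_derive_lam _) hB.
have dHA := @is_derive_compf _ (fun y => lam (Asol s (c y))) y _ _ (dH t lA) dlA.
have dHB := @is_derive_compf _ (fun y => lam (Bsol r (c y))) y _ _ (dH t lB) dlB.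
have h0 := is_derive_addf dHA (is_derive_oppf dHB).
have nV : \forall y' \near y, V (c y').
  apply: cc; rewrite cy; apply: open_nbhs_nbhs; split => //.
  exact: open_corner_set.
have e : \forall y' \near y, H t (lam (Asol s (c y'))) + - H t (lam (Bsol r (c y'))) =
    psi l1 l2 sigma (c y').1 (c y').2 t.
  by apply: filterS nV => y' Vy; rewrite psiE.
have [_ ] := near_eq_is_derive e h0.
by rewrite derive1E => ->; rewrite cy.
Qed.

Let rootsP p : V p ->
  [/\ 0 < Asol s p, 0 < Bsol r p,
      0 < 2 * Asol s p - (s * p.2 + 2 + s) & 0 < 2 * Bsol r p - (r * p.2 + 1)].
Proof.
move=> Vp; have [eA eB B1 BA A2 sA sB] := corner_sols hs hr a1_gt1 a2_gt1 Vp.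
have := a1_gt1 => a1'; split; lra.
Qed.

Lemma psi_zE t p : V p -> psi_z l1 l2 sigma p.1 p.2 t =
  cos (freq_A p * t) * amp_A p - cos (freq_B p * t) * amp_B p.
Proof.
move=> Vp; have [A0 B0 qA qB] := rootsP Vp.
have dq c d : is_derive p.2 1 (fun y => c * y + d) c.
  have h0 := is_derive_addf (is_derive_mulf (is_derive_constf p.2 c)
    (is_derive_idf p.2)) (is_derive_constf p.2 d).
  by apply: is_derive_eq h0 _; ring.
have hA : is_derive p.2 1 (fun y => Asol s (p.1, y)) (JA s p).
  have dq2 : is_derive p.2 1 (fun y => s * y + 2 + s) s.
    have h0 := is_derive_addf (dq s 2) (is_derive_constf p.2 s).
    by apply: is_derive_eq h0 _; rewrite addr0.
  have h0 := @is_derive_big_root (fun y => s * y + 2 + s) (fun=> s * (p.1 + 1)) p.2 _ _ qA dq2 (is_derive_constf p.2 (s * (p.1 + 1))).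
  by apply: is_derive_eq h0 _; rewrite subr0.
have hB : is_derive p.2 1 (fun y => Bsol r (p.1, y)) (JB r p).
  have h0 := @is_derive_big_root (fun y => r * y + 1) (fun=> - (r * (p.1 + 1))) p.2 _ _
    qB (dq r 1) (is_derive_constf p.2 (- (r * (p.1 + 1)))).
  by apply: is_derive_eq h0 _; rewrite subr0.
rewrite /psi_z (@dpsi t p (fun y => (p.1, y)) p.2 _ _ _ Vp _ hA hB).
- by rewrite /h /amp_A /amp_B /freq_A /freq_B; ring.
- by rewrite -surjective_pairing.
- move=> y; have c1 : p.1 @[_ --> y] --> p.1 by exact: cvg_cst.
  have c2 : y' @[y' --> y] --> y by exact: cvg_id.
  exact: (cvg_pair c1 c2).
Qed.

Lemma psi_xE t p : V p -> psi_x l1 l2 sigma p.1 p.2 t =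
  - (cos (freq_A p * t) * amp_A p / Asol s p) - cos (freq_B p * t) * amp_B p / Bsol r p.
Proof.
move=> Vp; have [A0 B0 qA qB] := rootsP Vp.
have dq c : is_derive p.1 1 (fun y => c * (y + 1)) c.
  have h0 := is_derive_mulf (is_derive_constf p.1 c)
    (is_derive_addf (is_derive_idf p.1) (is_derive_constf p.1 1)).
  by apply: is_derive_eq h0 _; ring.
have hA : is_derive p.1 1 (fun y => Asol s (y, p.2)) (- (JA s p / Asol s p)).
  have h0 := @is_derive_big_root (fun=> s * p.2 + 2 + s) (fun y => s * (y + 1)) p.1 _ _
    qA (is_derive_constf p.1 (s * p.2 + 2 + s)) (dq s).
  apply: is_derive_eq h0 _; rewrite /JA.
  by rewrite mul0r sub0r mulNr; congr (- _); rewrite mulrAC mulfK ?gt_eqF.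
have hB : is_derive p.1 1 (fun y => Bsol r (y, p.2)) (JB r p / Bsol r p).
  have h0 := @is_derive_big_root (fun=> r * p.2 + 1) (fun y => - (r * (y + 1))) p.1 _ _
    qB (is_derive_constf p.1 (r * p.2 + 1))
    (is_derive_oppf (dq r)).
  apply: is_derive_eq h0 _; rewrite /JB.
  by rewrite mul0r sub0r opprK [in RHS]mulrAC mulfK ?gt_eqF.
rewrite /psi_x (@dpsi t p (fun y => (y, p.2)) p.1 _ _ _ Vp _ hA hB).
- by rewrite /h /amp_A /amp_B /freq_A /freq_B; ring.
- by rewrite -surjective_pairing.
- move=> y; have c1 : p.2 @[_ --> y] --> p.2 by exact: cvg_cst.
  have c2 : y' @[y' --> y] --> y by exact: cvg_id.
  exact: (cvg_pair c2 c1).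
Qed.

(** Kernel of the cross term: [u] contributes the 1, [w] the [- 1/(ab)], because the [x]-derivatives
    of [a] and [b] carry factors [-1/a] and [1/b], and [v] the product of sines. *)
Definition kappa t a b : R :=
  cos (Num.sqrt (lam a) * t) * cos (Num.sqrt (lam b) * t) * (1 - (a * b)^-1) +
  sin (Num.sqrt (lam a) * t) * sin (Num.sqrt (lam b) * t) /
  (Num.sqrt (lam a) * Num.sqrt (lam b)).

Lemma energy_densityE t p : V p -> energy_density l1 l2 sigma t p =
  amp_A p ^+ 2 / lam (Asol s p) + amp_B p ^+ 2 / lam (Bsol r p)
  - 2 * (amp_A p * amp_B p * kappa t (Asol s p) (Bsol r p)).
Proof.
move=> Vp; have [A0 B0 _ _] := rootsP Vp.
have lam0 a : 0 < a -> 0 < lam a.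
  by move=> a0; rewrite divr_gt0 ?exprn_gt0// lam_den_gt0.
have fA0 : 0 < freq_A p by rewrite sqrtr_gt0 lam0.
have fB0 : 0 < freq_B p by rewrite sqrtr_gt0 lam0.
rewrite /energy_density /uvel /vvel /wvel.
have -> : (fun s0 => psi_z l1 l2 sigma p.1 p.2 s0) =
    (fun s0 => cos (freq_A p * s0) * amp_A p - cos (freq_B p * s0) * amp_B p).
  by apply/funext => s0; exact: psi_zE.
rewrite oint0_cosB ?gt_eqF// psi_zE// psi_xE// /kappa.
rewrite -[Num.sqrt (lam (Asol s p))]/(freq_A p) -[Num.sqrt (lam (Bsol r p))]/(freq_B p).
have eA : (lam (Asol s p))^-1 = 1 + (Asol s p)^-1 ^+ 2.
  by rewrite /lam; field; rewrite gt_eqF//= gt_eqF// lam_den_gt0.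
have eB : (lam (Bsol r p))^-1 = 1 + (Bsol r p)^-1 ^+ 2.
  by rewrite /lam; field; rewrite gt_eqF//= gt_eqF// lam_den_gt0.
have wA : (freq_A p)^-1 ^+ 2 = 1 + (Asol s p)^-1 ^+ 2.
  by rewrite -eA exprVn sqr_sqrtr// ltW// lam0.
have wB : (freq_B p)^-1 ^+ 2 = 1 + (Bsol r p)^-1 ^+ 2.
  by rewrite -eB exprVn sqr_sqrtr// ltW// lam0.
have cA := cos2Dsin2 (freq_A p * t); have cB := cos2Dsin2 (freq_B p * t).
rewrite eA eB (invfM (freq_A p)) (invfM (Asol s p)).
move: cA cB wA wB; move: (cos (freq_A p * t)) (sin (freq_A p * t)).
move: (cos (freq_B p * t)) (sin (freq_B p * t)) (amp_A p) (amp_B p).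
move: ((freq_A p)^-1) ((freq_B p)^-1) ((Asol s p)^-1) ((Bsol r p)^-1).
move=> wA wB iA iB cB sB gA gB cA sA eA1 eB1 eA2 eB2.
have -> : gA ^+ 2 * (1 + iA ^+ 2) = gA ^+ 2 * (cA ^+ 2 * (1 + iA ^+ 2) + sA ^+ 2 * wA ^+ 2).
  by rewrite eA2 -mulrDl eA1 mul1r.
have -> : gB ^+ 2 * (1 + iB ^+ 2) = gB ^+ 2 * (cB ^+ 2 * (1 + iB ^+ 2) + sB ^+ 2 * wB ^+ 2).
  by rewrite eB2 -mulrDl eB1 mul1r.
by ring.
Qed.

End corner.
End StreamFunction.

(** * Finiteness of the corner energies and cancellation *)

Section CornerEnergy.
Variable R : realType.
Notation mu := (@lebesgue_measure R).
Implicit Types (s r a b l t : R) (p : R * R).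

Definition bounded_on (V : set (R * R)) (f : R * R -> R) :=
  exists M, forall p, V p -> `|f p| <= M.

Lemma bounded_onM V f g : bounded_on V f -> bounded_on V g ->
  bounded_on V (fun p => f p * g p).
Proof.
move=> [M hM] [N hN]; exists (M * N) => p Vp.
by rewrite normrM ler_pM// ?hM ?hN.
Qed.

Lemma bounded_onD V f g : bounded_on V f -> bounded_on V g ->
  bounded_on V (fun p => f p + g p).
Proof.
move=> [M hM] [N hN]; exists (M + N) => p Vp.
by rewrite (le_trans (ler_normD _ _))// lerD// ?hM ?hN.
Qed.

Lemma bounded_onN V f : bounded_on V f -> bounded_on V (fun p => - f p).
Proof. by move=> [M hM]; exists M => p Vp; rewrite normrN hM. Qed.

Lemma bounded_on_cst V c : bounded_on V (fun=> c).
Proof. by exists `|c|. Qed.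

Lemma corner_set_fin s r a1 a2 : ((mu \x mu) (corner_set s r a1 a2) < +oo)%E.
Proof.
pose I : set (measurableTypeR R) := `]-1, 1[%classic.
pose J : set (measurableTypeR R) := `]-1, 0[%classic.
apply: (@le_lt_trans _ _ ((mu \x mu)%E (I `*` J))).
  apply: le_measure; rewrite ?inE; first exact: measurable_corner_set.
    by apply: measurableX; exact: measurable_itv.
  move=> p [[/andP[? ?] /andP[? ?]] _ _]; rewrite /I /J /= !in_itv /=.
  by split; apply/andP; split; lra.
rewrite product_measure1E; [|exact: measurable_itv|exact: measurable_itv].
have fin (c d : R) : (mu `]c, d[%classic < +oo)%E.
  by rewrite lebesgue_measure_itv /=; case: ifP => // _; rewrite -EFinB ltry.
apply: lte_mul_pinfty => //; last exact: fin.
by rewrite ge0_fin_numE//; exact: fin.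
Qed.

Lemma bounded_on_integrable s r a1 a2 (f : R * R -> R) :
  measurable_fun setT f -> bounded_on (corner_set s r a1 a2) f ->
  (mu \x mu)%E.-integrable (corner_set s r a1 a2) (EFin \o f).
Proof.
move=> mf [M hM]; apply: measurable_bounded_integrable.
- exact: measurable_corner_set.
- exact: corner_set_fin.
- exact: measurable_funTS.
- exists M; split; rewrite ?num_real// => x Mx p Vp /=.
  exact: le_trans (hM p Vp) (ltW Mx).
Qed.

Section fixed_amplitude.
Variables (l1 l2 : R) (sigma : R -> R).
Hypotheses (h1 : 2^-1 < l1) (h12 : l1 < l2) (h2 : l2 < 4 / 5)
  (csigma : continuous sigma) (bsigma : exists M, forall l, `|sigma l| <= M).

Let a1 := aof l1.
Let a2 := aof l2.
Let a1_gt1 : 1 < a1. Proof. by move: h1 h12 h2 => *; apply: aof_gt1; lra. Qed.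
Let a2_lt2 : a2 < 2. Proof. by move: h1 h12 h2 => *; apply: aof_lt2; lra. Qed.
Let a12 : a1 < a2.
Proof. by move: h1 h12 h2 => *; rewrite -lam_lt ?aof_ge0// !lam_aof; lra. Qed.
Let a2_gt1 : 1 < a2. Proof. exact: lt_trans a12. Qed.

Let k t a b := sigma (lam a) * dlam a * (sigma (lam b) * dlam b) * kappa t a b.

(** Written as a difference because [plane_substitution] requires a nonnegative kernel. It depends
    on neither [s] nor [r], so it is one quantity for all four corners. *)
Let cross t : \bar R :=
  ((\int[mu]_(a in `]a1, a2[) \int[mu]_(b in `]a1, a[)
      (Num.max (k t a b) 0 * (a * b / (a + b)))%:E) -
   (\int[mu]_(a in `]a1, a2[) \int[mu]_(b in `]a1, a[)
      (Num.max (- k t a b) 0 * (a * b / (a + b)))%:E))%E.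

Let mlam : measurable_fun setT (@lam R).
Proof. by rewrite /lam; measurability_tac. Qed.

Let mdlam : measurable_fun setT (@dlam R).
Proof. by rewrite /dlam; measurability_tac. Qed.

Let msigma : measurable_fun setT sigma.
Proof. exact: continuous_measurable_fun. Qed.

Let mcos : measurable_fun setT (@cos R).
Proof. by apply: continuous_measurable_fun; exact: continuous_cos. Qed.

Let msin : measurable_fun setT (@sin R).
Proof. by apply: continuous_measurable_fun; exact: continuous_sin. Qed.

Let mk t : measurable_fun setT (fun p : R * R => k t p.1 p.2).
Proof.
have m1 (f : R -> R) : measurable_fun setT f -> measurable_fun setT (fun p : R * R => f p.1).
  by move=> mf; exact: measurableT_comp.
have m2 (f : R -> R) : measurable_fun setT f -> measurable_fun setT (fun p : R * R => f p.2).
  by move=> mf; exact: measurableT_comp.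
have msl : measurable_fun setT (fun a => sigma (lam a)) by exact: measurableT_comp.
have mw : measurable_fun setT (fun a => Num.sqrt (lam a)).
  by apply: measurableT_comp mlam; exact: measurable_sqrt.
have mwt : measurable_fun setT (fun a => Num.sqrt (lam a) * t) by exact: measurable_funM.
have mc : measurable_fun setT (fun a => cos (Num.sqrt (lam a) * t)).
  exact: measurableT_comp.
have ms : measurable_fun setT (fun a => sin (Num.sqrt (lam a) * t)).
  exact: measurableT_comp.
rewrite /k /kappa; apply: measurable_funM.
  apply: measurable_funM; apply: measurable_funM.
  - exact: (m1 _ msl).
  - exact: (m1 _ mdlam).
  - exact: (m2 _ msl).
  - exact: (m2 _ mdlam).
apply: measurable_funD; apply: measurable_funM.
- by apply: measurable_funM; [exact: (m1 _ mc)|exact: (m2 _ mc)].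
- by measurability_tac.
- by apply: measurable_funM; [exact: (m1 _ ms)|exact: (m2 _ ms)].
- apply: measurable_funV; apply: measurable_funM; [exact: (m1 _ mw)|exact: (m2 _ mw)].
Qed.

Section fixed_corner.
Variables (s r : R).
Hypotheses (hs : is_sign s) (hr : is_sign r).

Let V := corner_set s r a1 a2.
Let X t p := k t (Asol s p) (Bsol r p) * `|JA s p * JB r p|.

Let intX t : (\int[mu \x mu]_(p in V) (X t p)%:E = cross t)%E.
Proof.
have mkP : measurable_fun setT (fun p : R * R => Num.max (k t p.1 p.2) 0).
  by apply: measurable_maxr; [exact: mk|exact: measurable_cst].
have mkN : measurable_fun setT (fun p : R * R => Num.max (- k t p.1 p.2) 0).
  by apply: measurable_maxr; [exact: measurable_funN|exact: measurable_cst].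
have kP a b : 0 <= Num.max (k t a b) 0 by rewrite le_max lexx orbT.
have kN a b : 0 <= Num.max (- k t a b) 0 by rewrite le_max lexx orbT.
rewrite integralE /cross.
rewrite -(@plane_substitution _ s r a1 a2 (fun a b => Num.max (k t a b) 0))//.
rewrite -(@plane_substitution _ s r a1 a2 (fun a b => Num.max (- k t a b) 0))//.
congr (_ - _)%E; apply: eq_integral => p _.
  by rewrite funeposE -EFin_max /X maxr_pMl ?mul0r// normr_ge0.
by rewrite funenegE -EFinN -EFin_max /X maxr_pMl ?mul0r// ?normr_ge0// mulNr.
Qed.

Let rootsP p : V p -> [/\ a1 < Asol s p, Asol s p < 2, a1 < Bsol r p, Bsol r p < 2 &
   a1 - 1 <= 2 * Asol s p - (s * p.2 + 2 + s) /\ a1 - 1 <= 2 * Bsol r p - (r * p.2 + 1)].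
Proof.
move=> Vp; have [eA eB B1 BA A2 sA sB] := corner_sols hs hr a1_gt1 a2_gt1 Vp.
by move: a1_gt1 a2_lt2 => *; do ! split; lra.
Qed.

(** [JA] has the sign of [s] and [JB] that of [r], their other factors being nonnegative on [V];
    this is where the sign of the corner appears. *)
Let XE t p : V p -> amp_A s sigma p * amp_B r sigma p * kappa t (Asol s p) (Bsol r p) =
  s * r * X t p.
Proof.
move=> Vp; have [A1 A2 B1 B2 [qA qB]] := rootsP Vp.
have a1' := a1_gt1.
have nA : JA s p = s * `|JA s p|.
  have c0 : 0 <= Asol s p / (2 * Asol s p - (s * p.2 + 2 + s)).
    by rewrite divr_ge0//; lra.
  have ns : `|s| = 1 by case: (hs) => ->; rewrite ?normrN normr1.
  by rewrite /JA -mulrA normrM (ger0_norm c0) ns mul1r.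
have nB : JB r p = r * `|JB r p|.
  have c0 : 0 <= Bsol r p / (2 * Bsol r p - (r * p.2 + 1)).
    by rewrite divr_ge0//; lra.
  have nr : `|r| = 1 by case: (hr) => ->; rewrite ?normrN normr1.
  by rewrite /JB -mulrA normrM (ger0_norm c0) nr mul1r.
by rewrite /X /k normrM /amp_A /amp_B {1}nA {1}nB; ring.
Qed.

Let bnd_inv (f : R * R -> R) c : 0 < c -> (forall p, V p -> c <= f p) ->
  bounded_on V (fun p => (f p)^-1).
Proof.
move=> c0 hf; exists c^-1 => p Vp.
have f0 := lt_le_trans c0 (hf p Vp).
have i0 : 0 <= (f p)^-1 by rewrite invr_ge0 ltW.
by rewrite (ger0_norm i0) lef_pV2 ?posrE// hf.
Qed.

Let bA : bounded_on V (Asol s).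
Proof.
exists 2 => p /rootsP[? ? _ _ _]; have := a1_gt1 => ?.
by rewrite ger0_norm; lra.
Qed.

Let bB : bounded_on V (Bsol r).
Proof.
exists 2 => p /rootsP[_ _ ? ? _]; have := a1_gt1 => ?.
by rewrite ger0_norm; lra.
Qed.

Let a1m : 0 < a1 - 1. Proof. by rewrite subr_gt0. Qed.

Let bJA : bounded_on V (JA s).
Proof.
apply: bounded_onM; first by apply: bounded_onM; [exact: bounded_on_cst|exact: bA].
by apply: (bnd_inv a1m) => p /rootsP[_ _ _ _ []].
Qed.

Let bJB : bounded_on V (JB r).
Proof.
apply: bounded_onM; first by apply: bounded_onM; [exact: bounded_on_cst|exact: bB].
by apply: (bnd_inv a1m) => p /rootsP[_ _ _ _ []].
Qed.

(** The bound 1 comes from [2|a| <= 1 + a^2 <= (1 + a^2)^2]. *)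
Let bdlam (f : R * R -> R) : bounded_on V (fun p => dlam (f p)).
Proof.
exists 1 => p _; rewrite /dlam normrM normfV (ger0_norm (sqr_ge0 _)).
have d0 := lam_den_gt0 (f p).
rewrite ler_pdivrMr ?exprn_gt0// mul1r ler_norml.
have q1 := sqr_ge0 (f p + 1); have q2 := sqr_ge0 (f p - 1); have q3 := sqr_ge0 (f p).
by apply/andP; split; nra.
Qed.

Let bsig (f : R * R -> R) : bounded_on V (fun p => sigma (f p)).
Proof. by have [M hM] := bsigma; exists M => p _. Qed.

Let lam_half a : 1 < a -> 2^-1 <= lam a.
Proof. by move=> a_1; rewrite /lam ler_pdivlMr ?lam_den_gt0//; nra. Qed.

Let sqrt_half a : 1 < a -> 2^-1 <= Num.sqrt (lam a).
Proof.
move=> /lam_half la; have h0 : (0 : R) <= 2^-1 by lra.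
by rewrite -(ger0_norm h0) -sqrtr_sqr ler_sqrt; lra.
Qed.

Let half_gt0 : 0 < 2^-1 :> R. Proof. lra. Qed.

Let gtA p : V p -> 1 < Asol s p.
Proof. by move=> /rootsP[+ _ _ _ _]; exact: lt_trans. Qed.

Let gtB p : V p -> 1 < Bsol r p.
Proof. by move=> /rootsP[_ _ + _ _]; exact: lt_trans. Qed.

Let bamp_A : bounded_on V (amp_A s sigma).
Proof. by apply: bounded_onM; [apply: bounded_onM|]. Qed.

Let bamp_B : bounded_on V (amp_B r sigma).
Proof. by apply: bounded_onM; [apply: bounded_onM|]. Qed.

Let bcos (f : R * R -> R) : bounded_on V (fun p => cos (f p)).
Proof. by exists 1 => p _; rewrite ler_norml cos_geN1 cos_le1. Qed.

Let bsin (f : R * R -> R) : bounded_on V (fun p => sin (f p)).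
Proof. by exists 1 => p _; rewrite ler_norml sin_geN1 sin_le1. Qed.

Let bkappa t : bounded_on V (fun p => kappa t (Asol s p) (Bsol r p)).
Proof.
apply: bounded_onD; apply: bounded_onM.
- exact: bounded_onM.
- apply: bounded_onD; first exact: bounded_on_cst.
  apply: bounded_onN; apply: (bnd_inv ltr01) => p Vp.
  by have := gtA Vp; have := gtB Vp; nra.
- exact: bounded_onM.
- have q0 : 0 < 2^-1 * 2^-1 :> R by rewrite mulr_gt0.
  apply: (bnd_inv q0) => p Vp; apply: ler_pM => //; do ?[exact: ltW].
    by apply: sqrt_half; exact: gtA.
  by apply: sqrt_half; exact: gtB.
Qed.

Let mamp_A : measurable_fun setT (amp_A s sigma).
Proof.
have mA := @measurable_Asol R s; apply: measurable_funM; last exact: measurable_JA.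
apply: measurable_funM; last exact: measurableT_comp.
by apply: measurableT_comp => //; exact: measurableT_comp.
Qed.

Let mamp_B : measurable_fun setT (amp_B r sigma).
Proof.
have mB := @measurable_Bsol R r; apply: measurable_funM; last exact: measurable_JB.
apply: measurable_funM; last exact: measurableT_comp.
by apply: measurableT_comp => //; exact: measurableT_comp.
Qed.

Let G p := amp_A s sigma p ^+ 2 / lam (Asol s p) + amp_B r sigma p ^+ 2 / lam (Bsol r p).

Let iG : (mu \x mu)%E.-integrable V (EFin \o G).
Proof.
apply: bounded_on_integrable.
  apply: measurable_funD; apply: measurable_funM;
    do ?[exact: measurable_funX]; apply: measurable_funV; apply: measurableT_comp => //.
    exact: measurable_Asol.
  exact: measurable_Bsol.
apply: bounded_onD; apply: bounded_onM.
- exact: bounded_onM.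
- by apply: (bnd_inv half_gt0) => p Vp; apply: lam_half; exact: gtA.
- exact: bounded_onM.
- by apply: (bnd_inv half_gt0) => p Vp; apply: lam_half; exact: gtB.
Qed.

Let bX t : bounded_on V (X t).
Proof.
apply: bounded_onM.
  apply: bounded_onM; last exact: bkappa.
  by apply: bounded_onM; apply: bounded_onM.
by have [M hM] := bounded_onM bJA bJB; exists M => p Vp; rewrite normr_id hM.
Qed.

Let iX t : (mu \x mu)%E.-integrable V (EFin \o X t).
Proof.
apply: bounded_on_integrable => //; apply: measurable_funM.
  have mAB : measurable_fun setT (fun p : R * R => (Asol s p, Bsol r p)).
    by apply: measurable_fun_pair; [exact: measurable_Asol|exact: measurable_Bsol].
  exact: (measurableT_comp (@mk t) mAB).
apply: measurableT_comp => //.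
by apply: measurable_funM; [exact: measurable_JA|exact: measurable_JB].
Qed.

(** The constant [e], the integral of the two square terms, is chosen before [t]. Integrability of
    both parts allows the integral to be split and leaves real numbers, for which the later
    cancellation is legitimate. *)
Lemma corner_set_energy : exists e : R, forall t,
  cross t \is a fin_num /\
  (energy_on (corner_set s r a1 a2) l1 l2 sigma t =
   (e - 2 * (s * r) * fine (cross t))%:E)%E.
Proof.
have mV := @measurable_corner_set R s r a1 a2.
exists (fine (\int[mu \x mu]_(p in V) (G p)%:E)%E) => t.
have fX : cross t \is a fin_num by rewrite -intX; exact: integrable_fin_num (iX t).
split => //.
rewrite /energy_on.
transitivity (\int[mu \x mu]_(p in V) ((G p)%:E - (2 * (s * r))%:E * (X t p)%:E))%E.
  apply: eq_integral => p /set_mem Vp.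
  rewrite (energy_densityE hs hr h1 h12 h2 csigma t Vp) XE// -EFinM -EFinB.
  by rewrite /G; congr EFin; ring.
have iZ : (mu \x mu)%E.-integrable V (fun p => ((2 * (s * r))%:E * (X t p)%:E)%E).
  by apply: integrableZl => //; exact: iX.
rewrite integralB//.
rewrite integralZl//; last exact: iX.
have fG : (\int[mu \x mu]_(p in V) (G p)%:E)%E \is a fin_num.
  exact: integrable_fin_num iG.
by rewrite intX -{1}(fineK fG) -{1}(fineK fX) -EFinM -EFinB.
Qed.

End fixed_corner.

Lemma corner_energy_const t1 t2 :
  corner_energy l1 l2 sigma t1 = corner_energy l1 l2 sigma t2.
Proof.
have P1 : is_sign (1 : R) by left.
have N1 : is_sign (-1 : R) by right.
have [c1 c2 c3 c4] := cornersE h1 h12 h2.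
rewrite /corner_energy c1 c2 c3 c4.
have [e1 E1] := corner_set_energy N1 P1; have [e2 E2] := corner_set_energy N1 N1.
have [e3 E3] := corner_set_energy P1 N1; have [e4 E4] := corner_set_energy P1 P1.
have tot t : (energy_on (corner_set (-1) 1 a1 a2) l1 l2 sigma t +
   energy_on (corner_set (-1) (-1) a1 a2) l1 l2 sigma t +
   energy_on (corner_set 1 (-1) a1 a2) l1 l2 sigma t +
   energy_on (corner_set 1 1 a1 a2) l1 l2 sigma t = (e1 + e2 + e3 + e4)%:E)%E.
  rewrite (E1 t).2 (E2 t).2 (E3 t).2 (E4 t).2 -!EFinD.
  by congr EFin; ring.
exact: etrans (tot t1) (esym (tot t2)).
Qed.

End fixed_amplitude.

(** Obtained by composing [f] with the clamping map onto [[c, d]]. The calculus above is stated for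
    an amplitude continuous and bounded on the whole line. *)
Lemma continuous_within_extension (f : R -> R) (c d : R) : c <= d ->
  {within `[c, d], continuous f} ->
  exists g : R -> R, [/\ continuous g, exists M, forall x, `|g x| <= M &
    forall x, c <= x <= d -> g x = f x].
Proof.
move=> cd cf; pose cl (x : R) := Num.max c (Num.min x d).
have Icl x : `[c, d]%classic (cl x).
  by rewrite /cl /= in_itv /= le_max lexx ge_max cd ge_min lexx orbT.
have ccl : continuous cl.
  move=> x; apply: (@continuous_max _ _ (cst c) (fun x => Num.min x d)).
    exact: cvg_cst.
  by apply: (@continuous_min _ _ id (cst d)); [exact: cvg_id|exact: cvg_cst].
exists (f \o cl); split.
- move=> x U fU; move/subspace_continuousP : cf => /(_ _ (Icl x)) cfx.
  have hU : \forall y \near cl x, `[c, d]%classic y -> U (f y) by exact: cfx.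
  have hx : \forall y \near x, `[c, d]%classic (cl y) -> U (f (cl y)).
    exact: (ccl x _ hU).
  have hx' : \forall y \near x, U (f (cl y)).
    by near=> y; apply: (near hx y) => //; exact: Icl.
  exact: hx'.
- have [M [_ hM]] := compact_bounded (continuous_compact cf (segment_compact (a := c) (b := d))).
  exists (M + 1) => x /=; apply: hM; first by rewrite ltrDl.
  by exists (cl x).
- by move=> x /andP[cx xd]; rewrite /cl /= (min_idPl xd) (max_idPr cx).
Unshelve. all: by end_near.
Qed.

End CornerEnergy.

Theorem theorem4p4 (R : realType) (l1 l2 : R) (sigma0 : R -> R)
  (hl1 : 2^-1 < l1) (hl12 : l1 < l2) (hl2 : l2 < 4 / 5)
  (hsc : {within `[2^-1, 4 / 5], continuous sigma0})
  (hsd : exists sigma0' : R -> R,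
      {within `[2^-1, 4 / 5], continuous sigma0'} /\
      forall l : R, 2^-1 < l < 4 / 5 -> is_derive l 1 sigma0 (sigma0' l)) :
  forall t1 t2 : R, corner_energy l1 l2 sigma0 t1 = corner_energy l1 l2 sigma0 t2.
Proof.
have h : 2^-1 <= 4 / 5 :> R by lra.
have [g [cg bg gE]] := continuous_within_extension h hsc.
(* Only values of the amplitude on [[l1, l2]], inside [[1/2, 4/5]], enter [psi], so the extension
   defines the same wave. *)
have psiE : psi l1 l2 sigma0 = psi l1 l2 g.
  apply/funext => x; apply/funext => z; apply/funext => t.
  apply: eq_Rintegral => l /set_mem /=; rewrite in_itv /= => /andP[? ?].
  by rewrite gE//; lra.
have enE t : corner_energy l1 l2 sigma0 t = corner_energy l1 l2 g t.
  rewrite /corner_energy /energy_on /energy_density /uvel /vvel /wvel /psi_z /psi_x.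
  by rewrite psiE.
by move=> t1 t2; rewrite !enE; exact: corner_energy_const.
Qed.
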